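(* Let $(X,d,\mu)$ be any PI space, let $f:(X,d)\to(Y,\rho)$ be a Lipschitz quotient map onto a metric space $(Y,\rho)$, and let $\nu=f_*\mu$. If $\nu$ is finite on some ball of $Y$, then $(Y,\rho,\nu)$ is a PI space.
   Context: Measures are Radon; the push-forward is $f_*\mu(A)=\mu(f^{-1}(A))$. A complete metric measure space $(Z,d,\mu)$ is a $p$-PI space ($1\le p<\infty$) if $\mu$ is doubling ($\mu(B(x,2r))\le C\mu(B(x,r))$ for all $x$, $r$, balls having positive finite measure) and there is $C>0$ with $\frac{1}{\mu(B)}\int_B|u-u_B|\,d\mu\le C\,\mathrm{diam}(B)\left(\frac1{\mu(CB)}\int_{CB}\mathrm{Lip}[u]^p\,d\mu\right)^{1/p}$ for every ball $B$ and every compactly supported Lipschitz $u:Z\to\mathbb R$, where $u_B$ is the $\mu$-average of $u$ on $B$ and $\mathrm{Lip}[u](x)=\limsup_{r\to0}\sup_{y\in B(x,r)}\frac{|u(y)-u(x)|}{r}$. A PI space is a $p$-PI space for some $p\in[1,\infty)$. A map $f:X\to Y$ between metric spaces is a Lipschitz quotient map if there is $L>0$ such that $B(f(x),L^{-1}r)\subseteq f(B(x,r))\subseteq B(f(x),Lr)$ for all $x\in X$, $r>0$ (open balls). Such a map is automatically surjective. *)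

(* Defs.v *)
From HB Require Import structures.
From mathcomp Require Import all_boot all_order all_algebra.
From mathcomp Require Import all_classical all_reals all_analysis.

Set Implicit Arguments.
Unset Strict Implicit.
Unset Printing Implicit Defensive.

Import Order.TTheory GRing.Theory Num.Theory.
Import numFieldNormedType.Exports.

Local Open Scope classical_set_scope.
Local Open Scope ring_scope.

(* Measurable types of MathComp-Analysis are pointed, so a metric space that
   carries a measure has to be pointed; the base point plays no other role. *)
#[short(type="pmetricType")]
HB.structure Definition PointedMetric (R : numDomainType) :=
  {T of Metric R T & isPointed T}.

Notation borelType X := (g_sigma_algebraType (@open X)).

Section lipschitz_quotient.
Context {R : realType}.

Definition lipschitz_quotient (X Y : metricType R) (f : X -> Y) : Prop :=
  exists2 L : R, 0 < L & forall (x : X) (r : R), 0 < r ->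
    ball (f x) (L^-1 * r) `<=` f @` ball x r /\
    f @` ball x r `<=` ball (f x) (L * r).

Lemma lipschitz_quotient_continuous (X Y : metricType R) (f : X -> Y) :
  lipschitz_quotient f -> continuous f.
Proof.
move=> [L L0 fL] x; apply/cvg_ballP => e e0.
have r0 : 0 < L^-1 * e by rewrite mulr_gt0 ?invr_gt0.
have [_ H] := fL x _ r0.
have fxe : f @` ball x (L^-1 * e) `<=` ball (f x) e.
  by move: H; rewrite mulrA divff ?mul1r// gt_eqF.
by apply: filterS (nbhsx_ballx x _ r0) => y xy; apply: fxe; exists y.
Qed.

Lemma lipschitz_quotient_measurable (X Y : pmetricType R) (f : X -> Y) :
  lipschitz_quotient f ->
  measurable_fun [set: borelType X] (f : borelType X -> borelType Y).
Proof.
move=> /lipschitz_quotient_continuous cf.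
apply: (@measurability _ _ (borelType X) (borelType Y) _ _ (@open Y)) => //.
move=> _ [B oB <-]; rewrite setTI; apply: sub_sigma_algebra.
by move/continuousP : cf; exact.
Qed.

(* [pushforward mu f] with the measure structure that the library derives from
   the measurability proof [mf], which inference cannot guess. *)
Definition pushforward_measure (X Y : pmetricType R) (mu : {measure set (borelType X) -> \bar R})
    (f : X -> Y)
    (mf : measurable_fun [set: borelType X]
      (f : borelType X -> borelType Y)) : {measure set (borelType Y) -> \bar R} :=
  measure_function_pushforward__canonical__measure_function_Measure mu mf.

End lipschitz_quotient.

Section PI_spaces.
Context {R : realType}.

(* The form of completeness required by MathComp-Analysis' completeType. *)
Definition complete_space (Z : pmetricType R) : Prop :=
  forall F : set_system Z, ProperFilter F -> cauchy F -> cvg F.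

Definition diam (Z : metricType R) (A : set Z) : R :=
  sup [set mdist a b | a in A & b in A].

Definition lipschitz_fun (Z : metricType R) (u : Z -> R) : Prop :=
  exists K : R, forall x y, `|u x - u y| <= K * mdist x y.

Definition compactly_supported (Z : metricType R) (u : Z -> R) : Prop :=
  compact (closure [set x | u x != 0]).

(* Lip[u](x) = limsup_(r -> 0+) sup_(y in B(x, r)) |u y - u x| / r *)
Definition Lip (Z : metricType R) (u : Z -> R) (x : Z) : \bar R :=
  limf_esup (fun r : R => ereal_sup [set (`|u y - u x| / r)%:E | y in ball x r])
    0^'+.

Variable Z : pmetricType R.
Variable mu : {measure set (borelType Z) -> \bar R}.

(* Locally finite and inner regular on Borel sets; when balls have finite
   measure in a proper space this agrees with the other usual definitions. *)
Definition radon : Prop :=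
  (forall x : Z, exists2 U : set Z, open_nbhs x U & (mu U < +oo)%E) /\
  (forall A : set (borelType Z), measurable A ->
    mu A = ereal_sup (mu @` [set K : set Z | compact K /\ K `<=` A])).

Definition doubling : Prop :=
  (forall (x : Z) (r : R), 0 < r ->
    (0 < mu (ball x r))%E /\ (mu (ball x r) < +oo)%E) /\
  exists C : R, forall (x : Z) (r : R), 0 < r ->
    (mu (ball x (2 * r)) <= C%:E * mu (ball x r))%E.

(* Averages are only taken over balls, whose measure is positive and finite. *)
Definition avg (B : set Z) (g : Z -> R) : R :=
  (fine (mu B))^-1 * \int[mu]_(x in B) g x.

Definition eavg (B : set Z) (g : Z -> \bar R) : \bar R :=
  ((fine (mu B))^-1%:E * \int[mu]_(x in B) g x)%E.

(* A ball is given by its centre and radius; C B is the concentric dilation. *)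
Definition poincare (p : R) : Prop :=
  exists2 C : R, 0 < C &
    forall (x : Z) (r : R) (u : Z -> R), 0 < r ->
      lipschitz_fun u -> compactly_supported u ->
      (eavg (ball x r) (fun y => `|u y - avg (ball x r) u|%:E)
       <= (C * diam (ball x r))%:E *
          (eavg (ball x (C * r)) (fun y => Lip u y `^ p)) `^ p^-1)%E.

Definition p_PI_space (p : R) : Prop :=
  [/\ complete_space Z, radon, doubling & poincare p].

Definition PI_space : Prop := exists2 p : R, 1 <= p & p_PI_space p.

End PI_spaces.

(* Main.v *)
(* Two disjoint sheets of X over Y may push mu forward to mutually singular
   measures, so the averages of u o f on the sheets cannot be compared directly;
   the exponent of the Poincare inequality has to be enlarged.

   Doubling of nu follows from a Vitali covering of a fibre of f. The same covering
   shows that every y in Y has, at every scale, a lift x such that the average of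
   (Lip u)^p o f on the ball at x is controlled by the average of (Lip u)^p at y.
   Applying the Poincare inequality of X on that single sheet, and using the
   Lipschitz constant A of u below scale s r, gives for d(x, y) < r
     |u x - u y| <= A s r + C_s r (average of Lip[u]^p on B(x, Lam r))^(1/p).
   This is bootstrapped with a maximal function. Suppose that the maximal function
   of Lip[u]^q is at most tau^q at x and y. The set E where it exceeds (2 tau)^q has
   relative measure O(2^-q). If |u a - u b| = O(tau d(a, b)) is already known off E,
   replace u by a McShane extension w of its restriction to the complement of E: then
   Lip[w] is controlled by Lip[u] off a slight enlargement of E and is O(tau) on it,
   so for s small and q large the inequality for w reproduces the bound
   |u x - u y| <= C tau r with the same constant C. Since u is Lipschitz the bound
   holds for large tau, hence for every tau by descending induction. The resulting
   pointwise estimate by the maximal function yields the q-Poincare inequality. *)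
Require Import Defs.
From HB Require Import structures.
From mathcomp Require Import all_boot all_order all_algebra.
From mathcomp Require Import all_classical all_reals all_analysis.
From mathcomp Require Import measurable_realfun.
From mathcomp Require Import lra ring.

Set Implicit Arguments.
Unset Strict Implicit.
Unset Printing Implicit Defensive.

Import Order.TTheory GRing.Theory Num.Theory.
Import numFieldNormedType.Exports.

Local Open Scope classical_set_scope.
Local Open Scope ring_scope.

Lemma exp2_ge (R : realType) (a : R) : exists k, a <= 2 ^+ k.
Proof.
exists (Num.truncn a).+1; apply: ltW; apply: lt_trans (truncnS_gt _) _.
by rewrite -natrX ltr_nat ltn_expl.
Qed.

(** * Pointwise Lipschitz constants *)

Section metric_facts.
Context {R : realType} {Z : metricType R}.
Implicit Types (x y z : Z) (u : Z -> R).

Lemma mem_ball x r y : ball x r y = (mdist x y < r).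
Proof. by rewrite ballEmdist. Qed.

Lemma sub_ball x y r s : mdist x y + r <= s -> ball x r `<=` ball y s.
Proof.
move=> h z; rewrite !mem_ball => xz.
have := metric_triangle y x z; rewrite (metric_sym y x); lra.
Qed.

Lemma open_mball x r : open (ball x r).
Proof.
rewrite openE => y; rewrite mem_ball /interior => xy.
rewrite -nbhs_ballE; exists (r - mdist x y) => /=; first by rewrite subr_gt0.
by apply: sub_ball; rewrite metric_sym; lra.
Qed.

Lemma ball_posr x r y : ball x r y -> 0 < r.
Proof. by rewrite mem_ball; apply: le_lt_trans; exact: mdist_ge0. Qed.

Lemma ball_ctr x r : 0 < r -> ball x r x.
Proof. by rewrite mem_ball mdistxx. Qed.

Lemma lipschitz_continuous u K :
  (forall x y, `|u x - u y| <= K * mdist x y) -> continuous u.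
Proof.
move=> uK x; apply/cvgrPdist_le => e e0.
have K0 : 0 < Num.max K 1 by rewrite lt_max ltr01 orbT.
near=> y.
have xy : mdist x y < e / Num.max K 1.
  rewrite -mem_ball; near: y; apply: nbhsx_ballx; exact: divr_gt0.
apply: le_trans (uK x y) _.
rewrite (@le_trans _ _ (Num.max K 1 * mdist x y))//.
  by rewrite ler_wpM2r ?mdist_ge0// le_max lexx.
by rewrite mulrC -ler_pdivlMr// ltW.
Unshelve. all: by end_near. Qed.

(** [Lip] divides by the radius of the ball, not by the distance to y. Letting the radius decrease
    to [mdist x y] turns the limsup into a bound on the increments of u themselves, the form used
    everywhere below. *)
Lemma Lip_leP u x (a : R) : 0 <= a -> (Lip u x <= a%:E)%E <->
  forall e, 0 < e -> exists2 t, 0 < t &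
    forall y, mdist x y < t -> `|u y - u x| <= (a + e) * mdist x y.
Proof.
move=> a0; split=> [ua e e0|H].
- have : (Lip u x < (a + e)%:E)%E.
    by apply: le_lt_trans ua _; rewrite lte_fin ltrDl.
  rewrite /Lip limf_esupE => /ereal_inf_lt[_ [A nA <-]] Ae.
  have /nbhs_ballP[t /= t0 tA] := nA; exists t => // y xy.
  suff key r : mdist x y < r -> r < t -> `|u y - u x| <= (a + e) * r.
    rewrite leNgt; apply/negP => h.
    have h1 : exists2 r, mdist x y < r < t & (a + e) * r < `|u y - u x|.
      have ae1 : 0 < a + e by lra.
      (* A radius strictly above [mdist x y], below t, and below the ratio at which the quotient
         would exceed [a + e]. *)
      exists (Num.min ((mdist x y + t) / 2)
                 ((mdist x y + `|u y - u x| / (a + e)) / 2)).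
        have h2 : mdist x y < `|u y - u x| / (a + e).
          by rewrite ltr_pdivlMr// mulrC.
        by rewrite lt_min gt_min; apply/andP; split; [|apply/orP; left]; lra.
      have h2 : mdist x y < `|u y - u x| / (a + e).
        by rewrite ltr_pdivlMr// mulrC.
      by rewrite mulrC -ltr_pdivlMr// gt_min; apply/orP; right; lra.
    have [r /andP[r1 r2]] := h1.
    by rewrite ltNge key.
  move=> xr rt; have r0 : 0 < r by apply: le_lt_trans xr; exact: mdist_ge0.
  have Ar : A r by apply: tA => //=; rewrite /ball/= sub0r normrN gtr0_norm.
  have : ((`|u y - u x| / r)%:E <= (a + e)%:E)%E.
    apply: le_trans (ltW Ae); apply: ereal_sup_ge => /=.
    eexists; first by exists r.
    apply: ereal_sup_ge; exists (`|u y - u x| / r)%:E => //.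
    by exists y => //; rewrite mem_ball.
  by rewrite lee_fin ler_pdivrMr.
- apply/lee_addgt0Pr => e e0; rewrite /Lip limf_esupE.
  have [t t0 tH] := H _ e0.
  have ae0 : 0 <= a + e.
    by lra.
  apply: ereal_inf_le.
  exists (ereal_sup ((fun r : R =>
    ereal_sup [set (`|u y - u x| / r)%:E | y in ball x r]) @` [set r | 0 < r < t])).
    exists [set r | 0 < r < t] => //.
    apply/nbhs_ballP; exists t => //= r /=.
    rewrite /ball/= sub0r normrN => rt r0; rewrite r0/=.
    by rewrite gtr0_norm in rt.
  apply: ge_ereal_sup => _ [r /= /andP[r0 rt] <-].
  apply: ge_ereal_sup => _ [y xy <-].
  rewrite lee_fin ler_pdivrMr//; move: xy; rewrite mem_ball => xy.
  apply: le_trans (tH y (lt_trans xy rt)) _.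
  by rewrite ler_wpM2l// ltW.
Qed.


Lemma Lip_ge0 u x : (0 <= Lip u x)%E.
Proof.
rewrite /Lip limf_esupE; apply: le_ereal_inf_tmp => _ [A nA <-].
have /nbhs_ballP[t /= t0 tA] := nA.
have At : A (t / 2).
  by apply: tA => /=; rewrite ?/ball/= ?sub0r ?normrN ?gtr0_norm; lra.
apply: ereal_sup_ge; eexists; first by exists (t / 2).
apply: ereal_sup_ge; exists (`|u x - u x| / (t / 2))%:E.
  by exists x => //; apply: ball_ctr; lra.
by rewrite lee_fin subrr normr0 mul0r.
Qed.

Definition lipk (K : R) u := forall x y, `|u x - u y| <= K * mdist x y.

Lemma Lip_le_lipk K u x : 0 <= K -> lipk K u -> (Lip u x <= K%:E)%E.
Proof.
move=> K0 uK; apply/Lip_leP => // e e0; exists 1 => // y _.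
rewrite distrC; apply: le_trans (uK _ _) _; rewrite ler_wpM2r ?mdist_ge0//; lra.
Qed.

(** An infinite [Lip u x] would give the default value 0; by [glipE] this does not occur for
    Lipschitz u. *)
Definition glip u x : R := fine (Lip u x).

Lemma glip_ge0 u x : 0 <= glip u x.
Proof. by rewrite fine_ge0// Lip_ge0. Qed.

Lemma glipE K u x : 0 <= K -> lipk K u -> Lip u x = (glip u x)%:E.
Proof.
move=> K0 uK; rewrite fineK// ge0_fin_numE ?Lip_ge0//.
by apply: le_lt_trans (Lip_le_lipk x K0 uK) _; rewrite ltry.
Qed.

Lemma glip_le_lipk K u x : 0 <= K -> lipk K u -> glip u x <= K.
Proof. by move=> K0 uK; rewrite -lee_fin -(glipE _ K0 uK) Lip_le_lipk. Qed.

Lemma glip_leP K u x (a : R) : 0 <= K -> lipk K u -> 0 <= a ->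
  glip u x <= a <->
  forall e, 0 < e -> exists2 t, 0 < t &
    forall y, mdist x y < t -> `|u y - u x| <= (a + e) * mdist x y.
Proof. by move=> K0 uK a0; rewrite -lee_fin -(glipE _ K0 uK); exact: Lip_leP. Qed.

(** The extension is the infimal convolution of u with the cone of slope A; any point of F provides
    the lower bound that makes the infimum meaningful. *)
Lemma mcshane (F : set Z) u A : F !=set0 -> 0 <= A ->
  (forall x y, F x -> F y -> `|u x - u y| <= A * mdist x y) ->
  exists2 w, lipk A w & forall x, F x -> w x = u x.
Proof.
move=> [a0 Fa0] A0 uA.
pose S z := [set u a + A * mdist a z | a in F].
have Sn z : S z !=set0 by exists (u a0 + A * mdist a0 z), a0.
have lbS z : has_lbound (S z).
  exists (u a0 - A * mdist a0 z) => _ [a Fa <-].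
  have := uA _ _ Fa0 Fa; rewrite ler_norml => /andP[_ h].
  have := ler_wpM2l A0 (metric_triangle a0 z a).
  rewrite mulrDr (metric_sym z a); lra.
have lipS z z' : inf (S z) <= inf (S z') + A * mdist z z'.
  rewrite -lerBlDr; apply: lb_le_inf => // _ [a Fa <-].
  have : inf (S z) <= u a + A * mdist a z by apply: inf_lbound => //; exists a.
  have := ler_wpM2l A0 (metric_triangle a z' z).
  rewrite mulrDr (metric_sym z' z); lra.
exists (fun z => inf (S z)) => [x y|x Fx].
  have := lipS x y; have := lipS y x; rewrite (metric_sym y x) ler_norml; lra.
apply/eqP; rewrite eq_le; apply/andP; split.
  by apply: inf_lbound => //; exists x => //; rewrite mdistxx mulr0 addr0.
apply: lb_le_inf => // _ [a Fa <-].
by have := uA _ _ Fx Fa; rewrite ler_norml (metric_sym x a); lra.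
Qed.

End metric_facts.

(** * Borel measurability of the pointwise Lipschitz constant *)

Section borel_metric.
Context {R : realType} {Z : pmetricType R}.
Implicit Types (x y : Z) (u : Z -> R).

Lemma borel_open (A : set Z) : open A -> measurable (A : set (borelType Z)).
Proof. by move=> oA; apply: sub_sigma_algebra. Qed.

Lemma borel_closed (A : set Z) : closed A -> measurable (A : set (borelType Z)).
Proof.
move=> cA; rewrite -(setCK A); apply: measurableC; apply: borel_open.
exact: closed_openC.
Qed.

Lemma borel_compact (A : set Z) : compact A -> measurable (A : set (borelType Z)).
Proof.
move=> cA; apply: borel_closed; apply: compact_closed => //.
exact: metric_hausdorff.
Qed.

Lemma borel_ball x r : measurable (ball x r : set (borelType Z)).
Proof. by apply: borel_open; exact: open_mball. Qed.

Lemma borel_continuous u : continuous u ->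
  measurable_fun [set: borelType Z] (u : borelType Z -> R).
Proof.
move=> cu; apply: (measurability _ (RGenOInfty.measurableE R)).
move=> _ [_ [a ->] <-]; rewrite setTI; apply: borel_open.
by move/continuousP : cu; apply; exact: interval_open.
Qed.

Lemma lipk_continuous K u : lipk K u -> continuous u.
Proof. exact: lipschitz_continuous. Qed.

Lemma lipk_measurable K u : lipk K u ->
  measurable_fun [set: borelType Z] (u : borelType Z -> R).
Proof. by move=> /lipk_continuous/borel_continuous. Qed.

(** A superlevel set of [glip u] is a countable union of countable intersections of open sets: at
    every scale [m.+1%:R^-1] some difference quotient at x exceeds a by a fixed margin
    [n.+1%:R^-1]. *)
Lemma glip_measurable K u : 0 <= K -> lipk K u ->
  measurable_fun [set: borelType Z] (glip u : borelType Z -> R).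
Proof.
move=> K0 uK; have cu := lipk_continuous uK.
apply: (measurability _ (RGenOInfty.measurableE R)) => _ [_ [a ->] <-].
rewrite setTI.
have [a0|a0] := ltP a 0.
  rewrite (_ : _ @^-1` _ = setT)//; apply/seteqP; split => // x _ /=.
  by rewrite in_itv/= andbT (lt_le_trans a0)// glip_ge0.
pose U (n m : nat) := [set x | exists2 y, mdist x y < m.+1%:R^-1 &
  (a + n.+1%:R^-1) * mdist x y < `|u y - u x|].
(* For each fixed y the two conditions are open in x, and U is the union over y. *)
have oU n m : open (U n m).
  pose G y := [set x | mdist x y < m.+1%:R^-1] `&`
    [set x | 0 < `|u y - u x| - (a + n.+1%:R^-1) * mdist x y].
  have -> : U n m = \bigcup_(y in setT) G y.
    apply/seteqP; split => [x [y h1 h2]|x [y _ [h1 h2]]].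
      by exists y => //; split => //=; rewrite subr_gt0.
    by exists y => //; move: h2 => /=; rewrite subr_gt0.
  apply: bigcup_open => y _; apply: openI.
    rewrite (_ : [set x | _] = ball y m.+1%:R^-1); first exact: open_mball.
    by apply/seteqP; split => x /=; rewrite mem_ball metric_sym.
  have : continuous (fun x => `|u y - u x| - (a + n.+1%:R^-1) * mdist x y).
    pose c := a + n.+1%:R^-1; rewrite -/c.
    apply: (@lipschitz_continuous _ _ _ (K + `|c|)) => x x'.
    have h1 : `| `|u y - u x| - `|u y - u x'| | <= K * mdist x x'.
      apply: le_trans (ler_dist_dist _ _) _.
      rewrite (_ : _ - _ - _ = - (u x - u x')); last by ring.
      by rewrite normrN; exact: uK.
    have h2 : `|c * mdist x y - c * mdist x' y| <= `|c| * mdist x x'.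
      rewrite -mulrBr normrM ler_wpM2l// ler_norml.
      have := metric_triangle x x' y; have := metric_triangle x' x y.
      by rewrite (metric_sym x' x); lra.
    rewrite [leRHS]mulrDl; apply: le_trans (lerD h1 h2).
    apply: (le_trans _ (ler_normB _ _)); rewrite le_eqVlt; apply/orP; left.
    by apply/eqP; congr (`| _ |); ring.
  move/continuousP => /(_ [set z | 0 < z]); apply.
  exact: open_gt.
have -> : glip u @^-1` `]a, +oo[%classic =
    \bigcup_n \bigcap_m (U n m).
  apply/seteqP; split => x /=.
    rewrite in_itv/= andbT ltNge => /negP h; apply: contrapT => h'; apply: h.
    apply/(glip_leP _ K0 uK a0) => e e0.
    have [n ne] := ltr_add_invr e0.
    have : ~ (\bigcap_m U n m) x by move=> ?; apply: h'; exists n.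
    move=> /existsNP[m /not_implyP[_ h]].
    exists m.+1%:R^-1; first by rewrite invr_gt0.
    move=> y xy; rewrite leNgt; apply/negP => h2; apply: h; exists y => //.
    apply: le_lt_trans h2; rewrite ler_wpM2r ?mdist_ge0// lerD2l.
    by move: ne; rewrite add0r => /ltW.
  move=> [n _ h]; rewrite in_itv/= andbT ltNge; apply/negP.
  move/(glip_leP _ K0 uK a0) => /(_ n.+1%:R^-1); rewrite invr_gt0 ltr0Sn.
  move=> /(_ isT)[t t0 ht].
  have [m mt] := ltr_add_invr t0.
  have [y xy] := h m I; rewrite ltNge ht//.
  by apply: lt_trans xy _; move: mt; rewrite add0r.
apply: bigcupT_measurable => n; apply: bigcapT_measurable => m.
exact: borel_open.
Qed.

End borel_metric.

(** * Doubling measures *)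

Section vitali_finite.
Context {R : realType} {Z : metricType R}.
Implicit Types (s : seq (Z * R)).

Definition pball (i : Z * R) : set Z := ball i.1 i.2.

Lemma max_radius s : s != [::] -> exists2 j, j \in s & forall i, i \in s -> i.2 <= j.2.
Proof.
elim: s => // a [|b s] IH _.
  by exists a; rewrite ?mem_head// => i; rewrite inE => /eqP ->.
have [//|j js jmax] := IH.
have [aj|ja] := leP a.2 j.2.
  exists j; first by rewrite inE js orbT.
  by move=> i; rewrite inE => /predU1P[->//|/jmax].
exists a; first exact: mem_head.
by move=> i; rewrite inE => /predU1P[->//|/jmax h]; apply: le_trans h (ltW ja).
Qed.

(** Greedy selection: keep a ball of largest radius, discard all balls meeting it, since they lie in
    its threefold dilation, and recurse on the rest. *)
Lemma vitali_finite s : (forall i, i \in s -> 0 < i.2) ->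
  exists D : seq (Z * R), [/\ uniq D, {subset D <= s}, trivIset [set` D] pball &
    forall i, i \in s -> exists2 j, j \in D & pball i `<=` ball j.1 (3 * j.2)].
Proof.
elim: {s}(size s) {-2}s (leqnn (size s)) => [|n IH] s sn s0.
  by exists [::]; split => //; move: sn; rewrite leqn0 size_eq0 => /eqP ->.
have [->|sN] := eqVneq s [::]; first by exists [::]; split.
have [j js jmax] := max_radius sN.
pose s' := [seq i <- s | `[< pball i `&` pball j = set0 >]].
have jj : pball j `&` pball j <> set0.
  by move=> h; have : set0 j.1 by rewrite -h; split; exact: ball_ctr (s0 _ js).
have s'n : (size s' <= n)%N.
  rewrite -ltnS; apply: leq_trans sn; rewrite size_filter ltn_neqAle count_size andbT.
  rewrite -all_count; apply/negP => /allP/(_ _ js)/asboolP; exact: jj.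
have [|D [uD Ds tD hD]] := IH s' s'n.
  by move=> i; rewrite mem_filter => /andP[_]; exact: s0.
have Dj i : i \in D -> pball i `&` pball j = set0.
  by move=> /Ds; rewrite mem_filter => /andP[/asboolP].
exists (j :: D); split.
- by rewrite /= uD andbT; apply/negP => /Dj.
- by move=> i; rewrite inE => /predU1P[->//|/Ds]; rewrite mem_filter => /andP[].
- move=> a b /=; rewrite !inE => /predU1P[->|aD] /predU1P[->|bD]//.
  + by rewrite setIC Dj// => /set0P/eqP.
  + by rewrite Dj// => /set0P/eqP.
  + exact: tD.
- move=> i si; have [ij|ij] := pselect (pball i `&` pball j = set0).
    have [|k kD ik] := hD i; first by rewrite mem_filter si andbT; apply/asboolP.
    by exists k => //; rewrite inE kD orbT.
  exists j; first exact: mem_head.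
  have /set0P[z [iz jz]] : pball i `&` pball j != set0 by apply/eqP.
  apply: sub_ball; have := metric_triangle i.1 z j.1.
  move: iz jz; rewrite /pball !mem_ball (metric_sym j.1 z) => iz jz.
  by have := jmax _ si; lra.
Qed.

End vitali_finite.

(** * Real-valued integrals, coverings and compactness for a doubling measure *)

Section doubling.
Context {R : realType} {Z : pmetricType R}.
Variable mu : {measure set (borelType Z) -> \bar R}.
Implicit Types (A B : set (borelType Z)) (x y : Z) (h g : Z -> R).

Definition vol A : R := fine (mu A).

Definition mint h A : R := \int[mu]_(x in A) h x.

(** Such functions are integrable on every set of finite measure, so real-valued integrals can be
    manipulated without further side conditions. *)
Definition adm h := [/\ measurable_fun [set: borelType Z] (h : borelType Z -> R),
  forall x, 0 <= h x & exists M, forall x, h x <= M].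

Definition finite_on_balls := forall x r, (mu (ball x r) < +oo)%E.

Hypothesis fmu : finite_on_balls.

Lemma adm_integrable h A : adm h -> measurable A -> (mu A < +oo)%E ->
  mu.-integrable A (EFin \o h).
Proof.
move=> [mh h0 [M hM]] mA fA; apply: measurable_bounded_integrable => //.
  exact: measurable_funS mh.
exists (`|M|); split; first exact: num_real.
move=> N MN x _ /=; rewrite ger0_norm//.
exact: le_trans (hM x) (le_trans (ler_norm M) (ltW MN)).
Qed.

Lemma mintE h A : adm h -> measurable A -> (mu A < +oo)%E ->
  (mint h A)%:E = (\int[mu]_(x in A) (h x)%:E)%E.
Proof.
move=> ah mA fA; rewrite /mint /Rintegral fineK//.
exact: integrable_fin_num (adm_integrable ah mA fA).
Qed.

Lemma volE A : (mu A < +oo)%E -> (vol A)%:E = mu A.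
Proof. by move=> fA; rewrite /vol fineK// ge0_fin_numE. Qed.

Lemma vol_ge0 A : 0 <= vol A.
Proof. exact: fine_ge0. Qed.

Lemma sub_fin A B : measurable A -> measurable B -> A `<=` B ->
  (mu B < +oo)%E -> (mu A < +oo)%E.
Proof.
by move=> mA mB AB; apply: le_lt_trans; apply: le_measure; rewrite ?inE.
Qed.

Lemma le_vol A B : measurable A -> measurable B -> (mu B < +oo)%E ->
  A `<=` B -> vol A <= vol B.
Proof.
move=> mA mB fB AB; rewrite -lee_fin !volE//; last exact: sub_fin fB.
by apply: le_measure; rewrite ?inE.
Qed.

Lemma vol_le_vol_ball A x r : measurable A -> A `<=` ball x r ->
  vol A <= vol (ball x r).
Proof. by move=> mA; apply: le_vol => //; exact: borel_ball. Qed.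

Lemma vol_leE A t : (mu A <= t%:E)%E -> vol A <= t.
Proof.
move=> At; rewrite -lee_fin volE//; apply: le_lt_trans At _; exact: ltry.
Qed.

Lemma mint_ge0 h A : adm h -> 0 <= mint h A.
Proof. by move=> [_ h0 _]; apply: Rintegral_ge0. Qed.

Lemma mint_subset h A B : adm h -> measurable A -> measurable B ->
  (mu B < +oo)%E -> A `<=` B -> mint h A <= mint h B.
Proof.
move=> ah mA mB fB AB; rewrite -lee_fin !mintE//; last exact: sub_fin fB.
have [mh h0 _] := ah; apply: ge0_subset_integral => //.
  by apply/measurable_EFinP; exact: measurable_funS mh.
by move=> x _; rewrite lee_fin.
Qed.

Lemma le_mint h g A : adm h -> adm g -> measurable A -> (mu A < +oo)%E ->
  (forall x, A x -> h x <= g x) -> mint h A <= mint g A.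
Proof.
move=> ah ag mA fA hg.
exact: (le_Rintegral mA (adm_integrable ah mA fA) (adm_integrable ag mA fA)).
Qed.

Lemma mint_cst c A : measurable A -> mint (fun=> c) A = c * vol A.
Proof. by move=> mA; rewrite /mint Rintegral_cst. Qed.

Lemma mintD h g A : adm h -> adm g -> measurable A -> (mu A < +oo)%E ->
  mint (fun x => h x + g x) A = mint h A + mint g A.
Proof.
move=> ah ag mA fA.
exact: (RintegralD mA (adm_integrable ah mA fA) (adm_integrable ag mA fA)).
Qed.

Lemma mintZ c h A : adm h -> measurable A -> (mu A < +oo)%E ->
  mint (fun x => c * h x) A = c * mint h A.
Proof. by move=> ah mA fA; exact: (RintegralZl _ mA (adm_integrable ah mA fA)). Qed.

Lemma mint_indic A B : measurable A -> measurable B ->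
  mint (fun x => \1_A x) B = vol (A `&` B).
Proof. by move=> mA mB; rewrite /mint /Rintegral /= integral_indic. Qed.

Lemma adm_cst c : 0 <= c -> adm (fun=> c).
Proof. by move=> c0; split => //; exists c. Qed.

Lemma adm_indic A : measurable A -> adm (fun x => \1_A x).
Proof.
move=> mA; split => [||]; first exact: measurable_indic.
  by move=> x; rewrite indicE.
by exists 1 => x; rewrite indicE; case: (_ \in _).
Qed.

Lemma admD h g : adm h -> adm g -> adm (fun x => h x + g x).
Proof.
move=> [mh h0 [M hM]] [mg g0 [N gN]]; split; first exact: measurable_funD.
  by move=> x; rewrite addr_ge0.
by exists (M + N) => x; rewrite lerD.
Qed.

Lemma admZ c h : 0 <= c -> adm h -> adm (fun x => c * h x).
Proof.
move=> c0 [mh h0 [M hM]]; split; first exact: measurable_funM.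
  by move=> x; rewrite mulr_ge0.
by exists (c * M) => x; rewrite ler_wpM2l.
Qed.

Lemma adm_powR p h : 0 <= p -> adm h -> adm (fun x => h x `^ p).
Proof.
move=> p0 [mh h0 [M hM]]; split.
- exact: (measurableT_comp (measurable_powR p) mh).
- by move=> x; exact: powR_ge0.
- exists (M `^ p) => x; apply: ge0_ler_powR => //; rewrite ?nnegrE//.
  exact: le_trans (h0 x) (hM x).
Qed.

Lemma adm_glip K h : 0 <= K -> lipk K h -> adm (glip h).
Proof.
move=> K0 hK; split; first exact: glip_measurable hK.
  by move=> x; exact: glip_ge0.
by exists K => x; exact: glip_le_lipk.
Qed.

Lemma sum_mint_le (I : choiceType) (s : seq I) (F : I -> set Z) h A : adm h ->
  (forall i, measurable (F i : set (borelType Z))) -> measurable A ->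
  (mu A < +oo)%E -> uniq s -> trivIset [set` s] F ->
  (forall i, i \in s -> F i `<=` A) ->
  \sum_(i <- s) mint h (F i) <= mint h A.
Proof.
move=> ah mF mA fA us ts sA.
pose D := \big[setU/set0]_(i <- s) (F i : set (borelType Z)).
have mD : measurable D by apply: bigsetU_measurable.
have DA : D `<=` A by rewrite /D -bigcup_seq => x [i /= /sA]; exact.
apply: le_trans (mint_subset ah mD mA fA DA).
have fD := sub_fin mD mA DA fA.
have [mh h0 _] := ah.
rewrite -lee_fin mintE// /D (@ge0_integral_bigsetU _ (borelType Z))//.
- rewrite -sumEFin big_seq [leRHS]big_seq; apply: lee_sum => i si.
  by rewrite mintE//; apply: sub_fin (mF i) mA (sA _ si) fA.
- by apply/measurable_EFinP; exact: measurable_funS mh.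
- by move=> x _; rewrite lee_fin.
Qed.

Lemma sum_vol_le (I : choiceType) (s : seq I) (F : I -> set Z) A :
  (forall i, measurable (F i : set (borelType Z))) -> measurable A ->
  (mu A < +oo)%E -> uniq s -> trivIset [set` s] F ->
  (forall i, i \in s -> F i `<=` A) ->
  \sum_(i <- s) vol (F i) <= vol A.
Proof.
move=> mF mA fA us ts sA.
rewrite -[leRHS]mul1r -mint_cst// (eq_bigr (fun i => mint (fun=> 1) (F i))).
  by apply: sum_mint_le => //; exact: adm_cst.
by move=> i _; rewrite mint_cst ?mul1r.
Qed.

(** The normalisation [1 <= C] keeps all powers of C at least 1. *)
Definition doubling_cst C := 1 <= C /\
  forall x r, 0 < r -> 0 < vol (ball x r) /\
    vol (ball x (2 * r)) <= C * vol (ball x r).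

Variable C : R.
Hypothesis dC : doubling_cst C.

Let C1 : 1 <= C. Proof. by case: dC. Qed.

Let C0 : 0 <= C. Proof. exact: le_trans ler01 C1. Qed.

Lemma vol_ball_gt0 x r : 0 < r -> 0 < vol (ball x r).
Proof. by move=> r0; have [_ /(_ x r r0)[]] := dC. Qed.

Lemma vol_ball_pow k x r : 0 < r -> vol (ball x (2 ^+ k * r)) <= C ^+ k * vol (ball x r).
Proof.
move=> r0; elim: k => [|k IH]; first by rewrite !expr0 !mul1r.
rewrite !exprS -!mulrA.
have [_ /(_ x (2 ^+ k * r))[|_ h]] := dC; first by rewrite mulr_gt0// exprn_gt0.
by apply: le_trans h _; rewrite ler_wpM2l.
Qed.

Lemma vol_ball_le k x y r s : 0 < r -> mdist x y + s <= 2 ^+ k * r ->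
  vol (ball x s) <= C ^+ k * vol (ball y r).
Proof.
move=> r0 h; apply: le_trans (vol_ball_pow k y r0).
apply: vol_le_vol_ball; first exact: borel_ball.
exact: sub_ball.
Qed.

Definition inner_regular := forall A, measurable A ->
  mu A = ereal_sup (mu @` [set K : set Z | compact K /\ K `<=` A]).

Hypothesis imu : inner_regular.

Lemma mu_bigsetU_le (s : seq (Z * R)) :
  (mu (\big[setU/set0]_(i <- s) ball i.1 (3 * i.2)) <=
   \sum_(i <- s) mu (ball i.1 (3 * i.2)))%E.
Proof.
elim: s => [|a s IH]; first by rewrite !big_nil measure0.
rewrite !big_cons; apply: le_trans (leeD2l _ IH).
apply: measureU2; first exact: borel_ball.
by apply: bigsetU_measurable => i _; exact: borel_ball.
Qed.

(* Inner regularity reduces the covering argument to finite families. *)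
Lemma vitali_cover T (F : set (Z * R)) : (forall i, F i -> 0 < i.2) ->
  (forall s : seq (Z * R), uniq s -> (forall i, i \in s -> F i) ->
    trivIset [set` s] pball -> \sum_(i <- s) vol (pball i) <= T) ->
  (mu (\bigcup_(i in F) pball i) <= (C ^+ 2 * T)%:E)%E.
Proof.
move=> F0 hT.
have oU : open (\bigcup_(i in F) pball i) by apply: bigcup_open => i _; exact: open_mball.
rewrite imu; last exact: borel_open.
apply: ge_ereal_sup => _ [K [cK KU] <-].
move: (cK); rewrite compact_cover => /(_ _ F pball).
move=> /(_ (fun i _ => open_mball i.1 i.2) KU) [D' D'F KD'].
have D'0 i : i \in finmap.enum_fset D' -> 0 < i.2 by move=> /D'F; rewrite inE; exact: F0.
have [D [uD DD' tD hD]] := vitali_finite D'0.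
pose U3 : set (borelType Z) := \big[setU/set0]_(i <- D) ball i.1 (3 * i.2).
have mU3 : measurable U3 by apply: bigsetU_measurable => i _; exact: borel_ball.
have KU3 : K `<=` U3.
  move=> z /KD'[i /= /hD[j jD ij] iz]; rewrite /U3 -bigcup_seq.
  by exists j => //; exact: ij.
have mK : measurable (K : set (borelType Z)) by exact: borel_compact.
apply: (@le_trans _ _ (mu U3)); first by apply: le_measure; rewrite ?inE.
apply: le_trans (mu_bigsetU_le D) _.
apply: (@le_trans _ _ (C ^+ 2 * \sum_(i <- D) vol (pball i))%:E); last first.
  rewrite lee_fin ler_wpM2l ?exprn_ge0//.
  by apply: hT => // i /DD'/D'F; rewrite inE.
rewrite mulr_sumr -sumEFin big_seq [leRHS]big_seq; apply: lee_sum => i iD.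
rewrite -volE// lee_fin; apply: vol_ball_le; first exact: D'0 (DD' _ iD).
have := D'0 _ (DD' _ iD); rewrite mdistxx; lra.
Qed.

Definition separated e (s : seq Z) :=
  uniq s /\ forall y z, y \in s -> z \in s -> y != z -> e <= mdist y z.

(** The balls of radius [e / 2] are disjoint and lie in [ball x (r + e)], while k doublings of each
    of them cover that ball; so each carries at least the fraction [C ^- k] of its measure. *)
Lemma separated_size k x r e (s : seq Z) : 0 < e -> separated e s ->
  4 * r + 2 * e <= 2 ^+ k * e -> (forall y, y \in s -> mdist x y < r) ->
  (size s)%:R <= C ^+ k.
Proof.
move=> e0 [us se] ke sx.
have [->|sN] := eqVneq s [::]; first by rewrite exprn_ge0.
have r0 : 0 < r.
  case: s sN sx {us se} => // a s _ /(_ a (mem_head _ _)).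
  by apply: le_lt_trans; exact: mdist_ge0.
pose V := vol (ball x (r + e)).
have V0 : 0 < V by apply: vol_ball_gt0; lra.
have ts : trivIset [set` s] (fun y => ball y (e / 2)).
  move=> a b /= sa sb [z []]; rewrite !mem_ball => az bz.
  apply/eqP; apply: contraT => ab; have := se _ _ sa sb ab.
  have := metric_triangle a z b; rewrite (metric_sym z b); lra.
have h1 : \sum_(y <- s) vol (ball y (e / 2)) <= V.
  apply: sum_vol_le => // [z||]; [exact: borel_ball|exact: borel_ball|].
  move=> y ys; apply: sub_ball => /=.
  by have := sx _ ys; rewrite metric_sym; lra.
have h2 : (size s)%:R * V <= C ^+ k * \sum_(y <- s) vol (ball y (e / 2)).
  rewrite mulr_sumr -sum1_size natr_sum mulr_suml.
  rewrite big_seq [leRHS]big_seq; apply: ler_sum => y ys; rewrite mul1r.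
  by apply: vol_ball_le => /=; [|have := sx _ ys; rewrite metric_sym]; lra.
rewrite -(ler_pM2r V0); apply: le_trans h2 _.
by rewrite ler_wpM2l// exprn_ge0.
Qed.

(** A maximal separated family is a net. If no net existed, separated families could be prolonged to
    any length, against [separated_size]. *)
Lemma finite_net k x r e : 0 < e -> 4 * r + 2 * e <= 2 ^+ k * e ->
  exists T : seq Z, [/\ forall y, y \in T -> mdist x y < r,
    (size T)%:R <= C ^+ k &
    forall y, mdist x y < r -> exists2 t, t \in T & mdist y t < e].
Proof.
move=> e0 ke; apply: contrapT => noT.
have H n : exists T : seq Z, [/\ size T = n, separated e T &
    forall y, y \in T -> mdist x y < r].
  elim: n => [|n [T [sT Te Tx]]]; first by exists [::]; split => //; split.
  apply: contrapT => h; apply: noT; exists T; split => //.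
    exact: separated_size Te ke Tx.
  move=> y xy; apply: contrapT => h2; apply: h.
  have h3 t : t \in T -> e <= mdist y t.
    by move=> tT; rewrite leNgt; apply/negP => yt; apply: h2; exists t.
  exists (y :: T); split => /=; first by rewrite sT.
    have [uT sepT] := Te; split.
      rewrite /= uT andbT; apply/negP => /h3.
      by rewrite mdistxx; lra.
    move=> a b; rewrite !inE => /predU1P[->|aT] /predU1P[->|bT].
    - by rewrite eqxx.
    - by move=> _; exact: h3.
    - by move=> _; rewrite metric_sym; exact: h3.
    - exact: sepT.
  by move=> a; rewrite inE => /predU1P[->//|/Tx].
have [T [sT Te Tx]] := H (Num.truncn (C ^+ k)).+1.
have := separated_size e0 Te ke Tx.
by rewrite leNgt sT truncnS_gt.
Qed.

(** Completeness and total boundedness: an ultrafilter on A contains one of the finitely many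
    e-balls of a net, hence is Cauchy. *)
Lemma closed_bounded_compact (A : set Z) x r : complete_space Z -> closed A ->
  A `<=` ball x r -> compact A.
Proof.
move=> cZ cA Ax; rewrite compact_ultra => F UF FA.
have PF : ProperFilter F by exact: ultra_proper.
have cF : cauchy F.
  apply: cauchy_exP => e e0.
  have [k hk] := exp2_ge ((4 * r + 2 * e) / e).
  have [|T [_ _ Tx]] := @finite_net k x r e e0; first by rewrite -ler_pdivrMr.
  apply: contrapT => h.
  have : F (A `&` [set z | forall t, t \in T -> ~ ball t e z]).
    apply: filterI => //; elim: {Tx}T => [|a T IH].
      by apply: filterS FA.
    have Fa : F (~` ball a e).
      have [Fb|//] := in_ultra_setVsetC (ball a e) UF.
      by exfalso; apply: h; exists a.
    apply: filterS (filterI Fa IH) => z [az zT] t.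
    by rewrite inE => /predU1P[->|/zT].
  move=> /filter_ex[z [Az zT]].
  have /= := Ax _ Az; rewrite mem_ball => /Tx[t tT zt].
  by apply: (zT t tT); rewrite mem_ball metric_sym.
have /cvg_ex[p Fp] := cZ F PF cF.
exists p; split => //.
apply: cA => B /Fp FB; exact: filter_ex (filterI FA FB).
Qed.

End doubling.

Lemma doubling_cstP {R : realType} {Z : pmetricType R}
    (mu : {measure set (borelType Z) -> \bar R}) : doubling mu ->
  finite_on_balls mu /\ exists C, doubling_cst mu C.
Proof.
move=> [mu0 [C hC]]; have fmu : finite_on_balls mu.
  move=> x r; have [r0|r0] := ltP 0 r; first by have [] := mu0 x r r0.
  rewrite (_ : ball x r = set0) ?measure0 ?ltry//.
  by apply/seteqP; split => // y /ball_posr; lra.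
have hC' x r : 0 < r -> 0 < vol mu (ball x r) /\
    vol mu (ball x (2 * r)) <= C * vol mu (ball x r).
  move=> r0; have [m0 _] := mu0 x r r0; split.
    by rewrite -lte_fin volE.
  by rewrite -lee_fin EFinM !volE//; exact: hC.
split=> //; exists (Num.max 1 C); split; first by rewrite le_max lexx.
move=> x r r0; have [v0 vC] := hC' x r r0; split=> //.
by apply: le_trans vC _; rewrite ler_wpM2r ?(ltW v0)// le_max lexx orbT.
Qed.

(** * Push-forward under a Lipschitz quotient map *)

Section quotient.
Context {R : realType} {X Y : pmetricType R}.
Variables (mu : {measure set (borelType X) -> \bar R}) (f : X -> Y).
Hypothesis hf : lipschitz_quotient f.
Local Notation nu := (pushforward_measure mu (lipschitz_quotient_measurable hf)).

Variable L : R.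
Hypothesis L1 : 1 <= L.
Hypothesis fLip : forall x x', mdist (f x) (f x') <= L * mdist x x'.
Hypothesis fLift : forall x y r, mdist (f x) y < r ->
  exists2 x', mdist x x' < L * r & f x' = y.

Let L0 : 0 < L. Proof. exact: lt_le_trans ltr01 L1. Qed.

Lemma quotient_surj y : exists x, f x = y.
Proof.
have [|x' _ <-] := @fLift point y (mdist (f point) y + 1); last by exists x'.
by rewrite ltrDl.
Qed.

Lemma nuE (A : set Y) : nu A = mu (f @^-1` A). Proof. by []. Qed.

Lemma quotient_continuous : continuous f.
Proof. exact: lipschitz_quotient_continuous. Qed.

Lemma measurable_preimage (A : set Y) : measurable (A : set (borelType Y)) ->
  measurable (f @^-1` A : set (borelType X)).
Proof.
by move=> mA; rewrite -[_ @^-1` _]setTI; exact: (lipschitz_quotient_measurable hf).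
Qed.

(** A compact K inside the preimage of A has a compact image inside A, whose [nu]-measure is at
    least that of K. *)
Lemma inner_regular_push : inner_regular mu -> inner_regular nu.
Proof.
move=> imu A mA; apply/eqP; rewrite eq_le; apply/andP; split; last first.
  apply: ge_ereal_sup => _ [K [cK KA] <-]; apply: le_measure; rewrite ?inE//.
  exact: borel_compact.
rewrite nuE (imu _ (measurable_preimage mA)).
apply: ge_ereal_sup => _ [K [cK KA] <-].
have cfK : compact (f @` K).
  apply: continuous_compact => //; apply: continuous_subspaceT.
  exact: quotient_continuous.
apply: ereal_sup_ge; exists (nu (f @` K)).
  by exists (f @` K) => //; split => // _ [x Kx <-]; exact: KA.
rewrite nuE; apply: le_measure; rewrite ?inE.
- exact: borel_compact.
- by apply: measurable_preimage; exact: borel_compact.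
- by move=> x Kx; exists x.
Qed.

(** A Cauchy filter on Y contains a unit ball, which by lifting lies in the image of a closed
    bounded, hence compact, subset of X. *)
Lemma complete_push :
  (forall (A : set X) x r, closed A -> A `<=` ball x r -> compact A) ->
  complete_space Y.
Proof.
move=> prX F PF cF.
have [y Fy] := (cauchyP F).1 cF 1 ltr01.
have [x fx] := quotient_surj y.
pose B := closure (ball x L).
have cB : compact B.
  apply: (prX _ x (L + 1)); first exact: closed_closure.
  move=> z /(_ (ball z 1) (nbhsx_ballx _ _ ltr01))[z' []].
  rewrite !mem_ball => h1 h2; have := metric_triangle x z' z.
  by rewrite (metric_sym z' z); lra.
have cfB : compact (f @` B).
  apply: continuous_compact => //; apply: continuous_subspaceT.
  exact: quotient_continuous.
apply: (compact_cauchy_cvg PF cF _ cfB).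
apply: filterS Fy => z; rewrite -fx mem_ball => /fLift[x' xx' <-].
by exists x' => //; apply: subset_closure; rewrite mem_ball; rewrite mulr1 in xx'.
Qed.

Variable C : R.
Hypothesis fmu : finite_on_balls mu.
Hypothesis dC : doubling_cst mu C.
Hypothesis imu : inner_regular mu.

Let C1 : 1 <= C. Proof. by case: dC. Qed.
Let C0 : 0 < C. Proof. exact: lt_le_trans ltr01 C1. Qed.

(** By lifting, the balls of radius t centred on the fibre over y cover the preimage of
    [ball y (t / L)]; the Vitali bound then needs only disjoint balls of this kind. *)
Lemma fiber_vitali T y t : 0 < t ->
  (forall s : seq (X * R), uniq s ->
    (forall i, i \in s -> f i.1 = y /\ i.2 = t) ->
    trivIset [set` s] pball -> \sum_(i <- s) vol mu (pball i) <= T) ->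
  (nu (ball y (t / L)) <= (C ^+ 2 * T)%:E)%E.
Proof.
move=> t0 hT; rewrite nuE.
pose F := [set i : X * R | f i.1 = y /\ i.2 = t].
apply: (@le_trans _ _ (mu (\bigcup_(i in F) pball i))).
  apply: le_measure; rewrite ?inE.
  - by apply: measurable_preimage; exact: borel_ball.
  - by apply: borel_open; apply: bigcup_open => i _; exact: open_mball.
  move=> x /=; rewrite mem_ball metric_sym => /fLift[x' xx' fx'].
  exists (x', t) => //; rewrite /pball mem_ball/= metric_sym.
  by move: xx'; rewrite mulrC divfK ?gt_eqF.
apply: (vitali_cover fmu dC imu) => [i [_ ->]//|s us sF ts].
exact: hT.
Qed.

Lemma preimage_ball_sub x y t r : f x = y -> L * t <= r -> ball x t `<=` f @^-1` ball y r.
Proof.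
move=> <- tr z; rewrite /= !mem_ball => xz.
by apply: le_lt_trans (fLip _ _) _; apply: lt_le_trans tr; rewrite ltr_pM2l.
Qed.

Lemma push_ball_doubling : exists2 C' : R, 1 <= C' &
  forall y r, 0 < r -> (nu (ball y (2 * r)) <= C'%:E * nu (ball y r))%E.
Proof.
have [k hk] := exp2_ge (2 * L * L).
exists (C ^+ 2 * C ^+ k) => [|y r r0].
  by rewrite mulr_ege1// exprn_ege1.
have CC : 0 < C ^+ 2 * C ^+ k by rewrite mulr_gt0// exprn_gt0.
have [->|fr] := eqVneq (nu (ball y r)) +oo%E.
  by rewrite gt0_muley ?leey.
have {}fr : (nu (ball y r) < +oo)%E by rewrite ltey.
have -> : 2 * r = 2 * L * r / L by rewrite mulrAC mulfK ?gt_eqF.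
rewrite -(volE fr) -EFinM -[C ^+ 2 * C ^+ k * _]mulrA.
have t0 : 0 < 2 * L * r by rewrite !mulr_gt0.
apply: fiber_vitali => // s us sF ts.
(* The disjoint balls of radius [2 * L * r] on the fibre are shrunk to radius [r / L], where they
   fit into the preimage of [ball y r]; k doublings recover their measure. *)
have h i : i \in s -> pball (i.1, r / L) `<=` f @^-1` ball y r.
  by move=> /sF[fi _]; apply: preimage_ball_sub => //=; rewrite mulrC divfK// gt_eqF.
have rL : 0 < r / L by rewrite divr_gt0.
have h1 : \sum_(i <- s) vol mu (pball (i.1, r / L)) <= vol mu (f @^-1` ball y r).
  apply: sum_vol_le => //.
  - by move=> i; exact: borel_ball.
  - by apply: measurable_preimage; exact: borel_ball.
  - move=> i j /= si sj [z [iz jz]]; apply: ts => //; exists z.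
    have [_ i2] := sF _ si; have [_ j2] := sF _ sj.
    have rL' : r / L <= 2 * L * r.
      rewrite ler_pdivrMr// mulrAC ler_pMl//.
      have : 1 <= L * L by rewrite mulr_ege1.
      lra.
    split; move: iz jz; rewrite /pball/= !mem_ball ?i2 ?j2; lra.
apply: (@le_trans _ _ (C ^+ k * \sum_(i <- s) vol mu (pball (i.1, r / L)))).
  rewrite mulr_sumr big_seq [leRHS]big_seq; apply: ler_sum => i si.
  have [_ i2] := sF _ si.
  apply: (vol_ball_le fmu dC) => //=; rewrite mdistxx add0r i2.
  by rewrite mulrA ler_pdivlMr// mulrAC; apply: ler_wpM2r => //; exact: ltW.
by rewrite ler_wpM2l// exprn_ge0// ltW.
Qed.

(** Doubling spreads finiteness from one ball to its dilations, which exhaust Y. Positivity holds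
    because the preimage of a ball contains a ball of X. *)
Lemma push_doubling : (exists y r, 0 < r /\ (nu (ball y r) < +oo)%E) ->
  doubling nu.
Proof.
move=> [y0 [r0 [r00 fy0]]].
have [C' C'1 dC'] := push_ball_doubling.
have fpow k : (nu (ball y0 (2 ^+ k * r0)) < +oo)%E.
  elim: k => [|k IH]; first by rewrite expr0 mul1r.
  rewrite exprS -mulrA; apply: le_lt_trans (dC' _ _ _) _.
    by rewrite mulr_gt0// exprn_gt0.
  by rewrite lte_mul_pinfty// lee_fin; lra.
split; last by exists C'.
move=> y r rp; split.
  have [x fx] := quotient_surj y.
  have rL : 0 < r / L by rewrite divr_gt0.
  apply: (@lt_le_trans _ _ (mu (ball x (r / L)))).
    by rewrite -volE// lte_fin (vol_ball_gt0 dC).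
  rewrite nuE; apply: le_measure; rewrite ?inE.
  - exact: borel_ball.
  - by apply: measurable_preimage; exact: borel_ball.
  - by apply: preimage_ball_sub => //; rewrite mulrC divfK// gt_eqF.
have [k hk] := exp2_ge ((mdist y y0 + r) / r0).
apply: le_lt_trans (fpow k); apply: le_measure; rewrite ?inE.
- exact: borel_ball.
- exact: borel_ball.
- by apply: sub_ball; rewrite -ler_pdivrMr.
Qed.

Lemma adm_comp (H : Y -> R) : adm H -> adm (H \o f).
Proof.
move=> [mH H0 [M HM]]; split.
- exact: (measurableT_comp mH (lipschitz_quotient_measurable hf)).
- by move=> x /=.
- by exists M => x /=.
Qed.

Variable C' : R.
Hypothesis fnu : finite_on_balls nu.
Hypothesis dC' : doubling_cst nu C'.

Let C'1 : 1 <= C'. Proof. by case: dC'. Qed.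

Lemma mint_push (H : Y -> R) A : adm H -> measurable A -> (nu A < +oo)%E ->
  mint mu (H \o f) (f @^-1` A) = mint nu H A.
Proof.
move=> aH mA fA; apply: EFin_inj; rewrite !mintE//; last 2 first.
- exact: adm_comp.
- exact: measurable_preimage.
have [mH H0 _] := aH.
rewrite [RHS](ge0_integral_pushforward (lipschitz_quotient_measurable hf))//.
  by apply/measurable_EFinP; exact: measurable_funS mH.
by move=> y _; rewrite lee_fin.
Qed.

(** If every lift failed, disjoint r-balls on the fibre would each carry more than [c * a] times
    their measure of the integral, so their total measure would be at most [V / c]. By
    [fiber_vitali] and doubling of [nu], the measure V of the large ball would then be too small. *)
Lemma good_lift : exists2 c : R, 0 < c & forall y r a (H : Y -> R), 0 < r -> 0 < a ->
  adm H -> mint nu H (ball y (L * r)) <= a * vol nu (ball y (L * r)) ->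
  exists2 x, f x = y &
    mint mu (H \o f) (ball x r) <= c * a * vol mu (ball x r).
Proof.
have [k hk] := exp2_ge (L * L).
(* The factor 2 turns the final estimate into the contradiction [V <= V / 2]. *)
pose c := 2 * C ^+ 2 * C' ^+ k.
have C'0 : 0 < C' by exact: lt_le_trans ltr01 C'1.
have c0 : 0 < c by rewrite !mulr_gt0// exprn_gt0.
exists c => // y r a H r0 a0 aH Ha; apply: contrapT => h.
have {}h x : f x = y -> c * a * vol mu (ball x r) <= mint mu (H \o f) (ball x r).
  by move=> fx; rewrite leNgt; apply/negP => h'; apply: h; exists x => //; exact: ltW.
pose V := vol nu (ball y (L * r)).
have V0 : 0 < V by apply: (vol_ball_gt0 dC'); rewrite mulr_gt0.
have : (nu (ball y (r / L)) <= (C ^+ 2 * (V / c))%:E)%E.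
  apply: fiber_vitali => // s us sF ts.
  have h1 : \sum_(i <- s) mint mu (H \o f) (pball i) <= a * V.
    apply: le_trans Ha; rewrite -mint_push//; last exact: borel_ball.
    apply: sum_mint_le => //.
    - exact: adm_comp.
    - by move=> i; exact: borel_ball.
    - by apply: measurable_preimage; exact: borel_ball.
    - exact: fnu.
    - by move=> i /sF[fi i2]; apply: preimage_ball_sub => //; rewrite i2.
  have ca0 : 0 < c * a by rewrite mulr_gt0.
  rewrite ler_pdivlMr// -(ler_pM2r a0) (mulrC V) -mulrA.
  apply: le_trans h1; rewrite mulr_suml big_seq [leRHS]big_seq.
  apply: ler_sum => i /sF[fi i2]; rewrite mulrC /pball i2; exact: h.
rewrite -volE// lee_fin => h1.
have rL0 : 0 < r / L by rewrite divr_gt0.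
have h2 : V <= C' ^+ k * vol nu (ball y (r / L)).
  apply: (vol_ball_le fnu dC') => //; rewrite mdistxx add0r.
  by rewrite mulrA ler_pdivlMr// mulrAC; apply: ler_wpM2r => //; exact: ltW.
have : V <= C' ^+ k * (C ^+ 2 * (V / c)).
  by apply: le_trans h2 _; rewrite ler_wpM2l// exprn_ge0// ltW.
have -> : C' ^+ k * (C ^+ 2 * (V / c)) = V / 2.
  rewrite /c; field.
  by rewrite !expf_neq0// gt_eqF.
lra.
Qed.

End quotient.

(** * A two-point estimate at a single scale, obtained from one sheet *)

Section lifted_poincare.
Context {R : realType}.

Lemma lipk_min (Z : metricType R) K (u v : Z -> R) : lipk K u -> lipk K v ->
  lipk K (fun x => Num.min (u x) (v x)).
Proof.
move=> uK vK x y; have := uK x y; have := vK x y.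
by rewrite !ler_norml /Num.min; do 2 case: ifPn; rewrite -?leNgt; lra.
Qed.

Lemma lipk_max (Z : metricType R) K (u v : Z -> R) : lipk K u -> lipk K v ->
  lipk K (fun x => Num.max (u x) (v x)).
Proof.
move=> uK vK x y; have := uK x y; have := vK x y.
by rewrite !ler_norml /Num.max; do 2 case: ifPn; rewrite -?leNgt; lra.
Qed.

Lemma lipk_opp (Z : metricType R) K (u : Z -> R) : lipk K u ->
  lipk K (fun x => - u x).
Proof. by move=> uK x y; have := uK x y; rewrite !ler_norml; lra. Qed.

(* Truncating between the tents -psi and psi makes the support bounded without
   increasing the Lipschitz constant. *)
Lemma lipschitz_cutoff (Z : metricType R) (K r : R) (u : Z -> R) x0 : 0 <= K -> lipk K u ->
  u x0 = 0 -> 0 < r ->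
  exists v : Z -> R, [/\ lipk K v, forall x, mdist x0 x <= r -> v x = u x,
    forall x, 2 * r <= mdist x0 x -> v x = 0 & forall x, `|v x| <= 2 * K * r].
Proof.
move=> K0 uK u0 r0.
pose psi x := Num.max 0 (K * (2 * r - mdist x0 x)).
have psiK : lipk K psi.
  apply: lipk_max => x y; first by rewrite subrr normr0 mulr_ge0// mdist_ge0.
  rewrite -mulrBr normrM ger0_norm// ler_wpM2l// ler_norml.
  have := metric_triangle x0 x y; have := metric_triangle x0 y x.
  by rewrite (metric_sym y x); lra.
have psi0 x : 0 <= psi x by rewrite /psi le_max lexx.
exists (fun x => Num.max (- psi x) (Num.min (u x) (psi x))); split.
- by apply: lipk_max; [exact: lipk_opp|exact: lipk_min].
- move=> x xr.
  have h1 : `|u x| <= psi x.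
    have := uK x x0; rewrite u0 subr0 => /le_trans; apply.
    rewrite /psi le_max; apply/orP; right. apply: ler_wpM2l => //.
    by rewrite metric_sym; lra.
  move: h1; rewrite ler_norml => /andP[h1 h2].
  by rewrite min_l// max_r.
- move=> x xr; have -> : psi x = 0.
    by rewrite /psi max_l// mulr_ge0_le0//; lra.
  by rewrite oppr0 max_l// ge_min lexx orbT.
- move=> x; have h : psi x <= 2 * K * r.
    rewrite /psi ge_max; apply/andP; split; first by rewrite !mulr_ge0// ltW.
    rewrite (_ : 2 * K * r = K * (2 * r)); last by ring.
    apply: ler_wpM2l => //.
    by have := mdist_ge0 x0 x; lra.
  rewrite ler_norml; have := psi0 x; rewrite /Num.max /Num.min.
  by do 2 case: ifPn; rewrite -?leNgt; lra.
Qed.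

Lemma diam_ball_le (Z : metricType R) (x : Z) r : 0 < r -> diam (ball x r) <= 2 * r.
Proof.
move=> r0; apply: ge_sup.
  by exists (mdist x x), x; [exact: ball_ctr|exists x => //; exact: ball_ctr].
move=> _ [a xa [b xb <-]]; move: xa xb; rewrite !mem_ball => xa xb.
have := metric_triangle a x b; rewrite (metric_sym a x); lra.
Qed.

(** Only one scale is involved, because lifts chosen at different scales may differ and their
    averages do not telescope. The error [A * s * r] pays for replacing point values by averages on
    small balls; [Cs] depends on s but not on w, A or a. *)
Definition two_point_poincare (Z : pmetricType R)
    (nu : {measure set (borelType Z) -> \bar R}) (p : R) :=
  exists2 Lam, 0 < Lam & forall s, 0 < s -> exists2 Cs, 0 < Cs &
    forall (w : Z -> R) A x y r a, 0 < r -> 0 <= A -> 0 < a -> lipk A w ->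
    mdist x y < r ->
    mint nu (fun z => glip w z `^ p) (ball x (Lam * r)) <=
      a `^ p * vol nu (ball x (Lam * r)) ->
    `|w x - w y| <= A * s * r + Cs * a * r.

End lifted_poincare.

Section lift.
Context {R : realType} {X Y : pmetricType R}.
Variables (mu : {measure set (borelType X) -> \bar R}) (f : X -> Y).
Hypothesis hf : lipschitz_quotient f.
Local Notation nu := (pushforward_measure mu (lipschitz_quotient_measurable hf)).
Variable L : R.
Hypothesis L1 : 1 <= L.
Hypothesis fLip : forall x x', mdist (f x) (f x') <= L * mdist x x'.
Hypothesis fLift : forall x y r, mdist (f x) y < r ->
  exists2 x', mdist x x' < L * r & f x' = y.
Variables (C C' : R).
Hypothesis fmu : finite_on_balls mu.
Hypothesis dC : doubling_cst mu C.
Hypothesis imu : inner_regular mu.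
Hypothesis fnu : finite_on_balls nu.
Hypothesis dC' : doubling_cst nu C'.
Hypothesis prX : forall (A : set X) x r, closed A -> A `<=` ball x r -> compact A.
Variable p : R.
Hypothesis p1 : 1 <= p.
Hypothesis pX : poincare mu p.

Let L0 : 0 < L. Proof. exact: lt_le_trans ltr01 L1. Qed.
Let p0 : 0 < p. Proof. exact: lt_le_trans ltr01 p1. Qed.

(** Real-valued form of the inequality upstairs. Bounded support suffices since X is proper, and the
    diameter is bounded by [2 * r]. *)
Lemma poincare_mint : exists2 Cp, 0 < Cp & forall (v : X -> R) K x r b x0 r0,
  0 < r -> 0 <= K -> 0 <= b ->
  lipk K v -> (forall z, r0 <= mdist x0 z -> v z = 0) ->
  (exists M, forall z, `|v z| <= M) ->
  mint mu (fun z => glip v z `^ p) (ball x (Cp * r)) <=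
     b `^ p * vol mu (ball x (Cp * r)) ->
  exists m, mint mu (fun z => `|v z - m|) (ball x r) <=
     Cp * (2 * r) * b * vol mu (ball x r).
Proof.
have [Cp Cp0 hP] := pX; exists Cp => // v K x r b x0 r0 rp K0 b0 vK v0 [M vM] hb.
exists (avg mu (ball x r) v) => //; set m := avg _ _ _.
have B1 := vol_ball_gt0 dC x rp.
have B2 : 0 < vol mu (ball x (Cp * r)) by apply: (vol_ball_gt0 dC); rewrite mulr_gt0.
have av : adm (fun z => `|v z - m|).
  split.
  - apply: (measurableT_comp (@normr_measurable R setT)).
    by apply: measurable_funB => //; exact: lipk_measurable vK.
  - by move=> z.
  - exists (M + `|m|) => z; apply: le_trans (ler_normB _ _) _; exact: lerD.
have cv : compactly_supported v.
  apply: (prX (x := x0) (r := r0 + 1)); first exact: closed_closure.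
  move=> z /(_ (ball z 1) (nbhsx_ballx _ _ ltr01))[z' [/= vz']].
  have : mdist x0 z' < r0.
    by rewrite ltNge; apply: contra vz' => /v0 ->.
  rewrite !mem_ball => h1 h2; have := metric_triangle x0 z' z.
  by rewrite (metric_sym z' z); lra.
have /(_ rp (ex_intro _ K vK) cv) := hP x r v.
have ag : adm (fun z => glip v z `^ p) by apply: adm_powR (ltW p0) (adm_glip K0 vK).
rewrite /eavg -/m -mintE//; [|exact: borel_ball].
have -> : (\int[mu]_(z in ball x (Cp * r)) (Lip v z `^ p))%E =
    (mint mu (fun z => glip v z `^ p) (ball x (Cp * r)))%:E.
  rewrite mintE//; last exact: borel_ball.
  by apply: eq_integral => z _; rewrite (glipE z K0 vK) poweR_EFin.
rewrite -!EFinM lee_fin -/(vol _ _) -/(vol _ _) => h.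
rewrite -ler_pdivrMr// mulrC; apply: le_trans h _.
have d1 := diam_ball_le x rp.
have h3 : ((vol mu (ball x (Cp * r)))^-1 *
    mint mu (fun z => glip v z `^ p) (ball x (Cp * r))) `^ p^-1 <= b.
  have -> : b = (b `^ p) `^ p^-1 by rewrite -powRrM divff ?gt_eqF// powRr1.
  apply: ge0_ler_powR; rewrite ?invr_ge0 ?nnegrE ?powR_ge0 ?(ltW p0)//.
    by rewrite mulr_ge0 ?mint_ge0// invr_ge0 ltW.
  by rewrite mulrC ler_pdivrMr.
apply: (@le_trans _ _ (Cp * (2 * r) * ((vol mu (ball x (Cp * r)))^-1 *
    mint mu (fun z => glip v z `^ p) (ball x (Cp * r))) `^ p^-1)).
  by apply: ler_wpM2r; [exact: powR_ge0|rewrite ler_pM2l].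
by apply: ler_wpM2l => //; rewrite !mulr_ge0// ltW.
Qed.

(** Chain rule for the L-Lipschitz map f; it is local, so v may be a cut-off of [w \o f] up to a
    constant. *)
Lemma glip_comp_le (w : Y -> R) A (v : X -> R) K x0 r z : 0 <= A -> lipk A w ->
  0 <= K -> lipk K v ->
  (forall z', mdist x0 z' <= r -> v z' = w (f z') - w (f x0)) ->
  mdist x0 z < r -> glip v z <= L * glip w (f z).
Proof.
move=> A0 wA K0 vK hv zr; have g0 := glip_ge0 w (f z).
apply/(glip_leP _ K0 vK); first by rewrite mulr_ge0// ltW.
move=> e e0.
have [t t0 ht] := (glip_leP (f z) A0 wA g0).1 (lexx _) (e / L) (divr_gt0 e0 L0).
exists (Num.min (t / L) (r - mdist x0 z)).
  by rewrite lt_min divr_gt0//= subr_gt0.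
move=> y; rewrite lt_min => /andP[zy1 zy2].
rewrite !hv; [|exact: ltW|by have := metric_triangle x0 z y; lra].
have fzy := fLip z y.
have fzy' : mdist (f z) (f y) < t.
  by apply: le_lt_trans fzy _; rewrite mulrC -ltr_pdivlMr.
rewrite (_ : _ - _ - _ = w (f y) - w (f z)); last by ring.
apply: le_trans (ht _ fzy') _.
apply: (@le_trans _ _ ((glip w (f z) + e / L) * (L * mdist z y))).
  by apply: ler_wpM2l => //; rewrite addr_ge0// ltW// divr_gt0.
rewrite le_eqVlt; apply/orP; left; apply/eqP; field; exact: lt0r_neq0.
Qed.

(* Only the sheet through a well-chosen lift of x is used: there the average of
   the gradient is controlled by its average downstairs. *)
Lemma two_point_poincare_push : two_point_poincare nu p.
Proof.
have [Cp Cp0 hP] := poincare_mint.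
have [c c0 hc] := good_lift L1 fLip fLift fmu dC imu fnu dC'.
exists (L * (Cp * (2 * L))); first by rewrite !mulr_gt0.
(* The first bound makes the two point-to-average errors sum to at most [A * s * r]; the second
   keeps the averaging balls inside [ball x' (2 * L * r)]. *)
move=> s s0; pose s' := Num.min (s / (2 * L)) L.
have s'0 : 0 < s' by rewrite lt_min L0 divr_gt0// mulr_gt0.
have [k hk] := exp2_ge (3 * L / s').
(* L comes from the chain rule, the power of c from the good lift, whose bound is on p-th powers. *)
pose b0 := L * c `^ p^-1.
have b00 : 0 < b0 by rewrite mulr_gt0// powR_gt0.
exists (2 * (C ^+ k * (Cp * (2 * (2 * L)) * b0))).
  have C0 : 0 < C by have [C1 _] := dC; exact: lt_le_trans ltr01 C1.
  by rewrite !mulr_gt0// ?powR_gt0// ?exprn_gt0.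
move=> w A x y r a r0 A0 a0 wA xy ha.
have ag : adm (fun z => glip w z `^ p) by apply: adm_powR (ltW p0) (adm_glip A0 wA).
pose rho := Cp * (2 * L * r).
have rho0 : 0 < rho by rewrite !mulr_gt0.
have Lr0 : 0 < 2 * L * r by rewrite !mulr_gt0.
have Lrho : L * (Cp * (2 * L)) * r = L * rho by rewrite /rho; ring.
rewrite Lrho in ha.
have [x' fx' hx'] := hc x rho (a `^ p) _ rho0 (powR_gt0 p a0) ag ha.
(* The lift of y is taken near [x'], so both points are seen by one ball of X. *)
have [|y' xy' fy'] := @fLift x' y r; first by rewrite fx'.
pose R1 := 2 * L * r + rho.
have R10 : 0 < R1 by rewrite addr_gt0// !mulr_gt0.
pose K := A * L.
have K0 : 0 <= K by rewrite mulr_ge0// ltW.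
pose u z := w (f z) - w x.
have uK : lipk K u.
  move=> z z'; rewrite /u (_ : _ - _ - _ = w (f z) - w (f z')); last by ring.
  by apply: le_trans (wA _ _) _; rewrite /K -mulrA; apply: ler_wpM2l.
have ux0 : u x' = 0 by rewrite /u fx' subrr.
have [v [vK vu v0 vM]] := lipschitz_cutoff K0 uK ux0 R10.
have hv z' : mdist x' z' <= R1 -> v z' = w (f z') - w (f x').
  by move=> /vu ->; rewrite /u fx'.
have b0a : 0 <= b0 * a by rewrite mulr_ge0// ltW.
have gv : mint mu (fun z => glip v z `^ p) (ball x' rho) <=
    (b0 * a) `^ p * vol mu (ball x' rho).
  have agv : adm (fun z => glip v z `^ p) by apply: adm_powR (ltW p0) (adm_glip K0 vK).
  have agf := adm_comp hf ag.
  have Lp : 0 <= L `^ p by exact: powR_ge0.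
  apply: (@le_trans _ _ (L `^ p * (c * a `^ p * vol mu (ball x' rho)))).
    apply: le_trans (ler_wpM2l Lp hx').
    rewrite -mintZ//; last exact: borel_ball.
    apply: le_mint => //; first exact: admZ.
      exact: borel_ball.
    move=> z; rewrite mem_ball => xz /=.
    rewrite -[L `^ p * _](powRM p (ltW L0) (glip_ge0 _ _)).
    apply: ge0_ler_powR; rewrite ?nnegrE ?glip_ge0 ?(ltW p0)//.
      by rewrite mulr_ge0 ?glip_ge0// ltW.
    apply: (glip_comp_le A0 wA K0 vK hv).
    by apply: lt_trans xz _; rewrite /R1 ltrDr !mulr_gt0.
  rewrite /b0 !powRM ?powR_ge0 ?(ltW L0) ?(ltW a0)//; last first.
    by rewrite mulr_ge0 ?powR_ge0// ltW.
  rewrite -powRrM mulVf ?gt_eqF// powRr1 ?(ltW c0)//.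
  by rewrite !mulrA.
have [m hm] := hP v K x' (2 * L * r) (b0 * a) x' (2 * R1) Lr0 K0 b0a vK v0
  (ex_intro _ _ vM) gv.
set M := Cp * (2 * (2 * L * r)) * (b0 * a) in hm.
have M0 : 0 <= M by apply: mulr_ge0 => //; rewrite mulr_ge0// ?ltW// mulr_gt0.
have ME : M = Cp * (2 * (2 * L * r)) * (b0 * a) by [].
clearbody M.
have C0 : 0 <= C by have [C1 _] := dC; exact: le_trans ler01 C1.
have av : adm (fun z => `|v z - m|).
  split.
  - apply: (measurableT_comp (@normr_measurable R setT)).
    by apply: measurable_funB => //; exact: lipk_measurable vK.
  - by move=> z.
  - exists (2 * K * R1 + `|m|) => z; apply: le_trans (ler_normB _ _) _; exact: lerD.
(* Average over [ball q (s' * r)]: moving from q inside this ball costs [K * (s' * r)], and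
   enlarging the ball to [ball x' (2 * L * r)] costs k doublings. *)
have key q : mdist x' q < L * r -> `|v q - m| <= K * (s' * r) + C ^+ k * M.
  move=> x'q.
  have sr0 : 0 < s' * r by rewrite mulr_gt0.
  have V0 := vol_ball_gt0 dC q sr0.
  have s'L : s' * r <= L * r.
    by apply: ler_wpM2r; rewrite ?(ltW r0)// ge_min lexx orbT.
  have qsub : ball q (s' * r) `<=` ball x' (2 * L * r).
    apply: sub_ball; rewrite metric_sym (_ : 2 * L * r = L * r + L * r); last by ring.
    by apply: lerD => //; exact: ltW.
  have mq : measurable (ball q (s' * r) : set (borelType X)) by exact: borel_ball.
  rewrite -(ler_pM2r V0) mulrDl -{1}mint_cst//.
  apply: (@le_trans _ _ (mint mu (fun z => K * (s' * r) + `|v z - m|) (ball q (s' * r)))).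
    apply: le_mint => //; first exact: adm_cst.
      apply: admD => //; apply: adm_cst; rewrite mulr_ge0//; exact: ltW.
    move=> z; rewrite mem_ball => qz.
    have h := vK q z.
    have h2 : K * mdist q z <= K * (s' * r) by apply: ler_wpM2l => //; exact: ltW.
    rewrite (_ : v q - m = (v q - v z) + (v z - m)); last by ring.
    by apply: le_trans (ler_normD _ _) _; rewrite lerD2r; apply: le_trans h h2.
  rewrite mintD//; last by apply: adm_cst; rewrite mulr_ge0//; exact: ltW.
  rewrite mint_cst// lerD2l.
  apply: (@le_trans _ _ (mint mu (fun z => `|v z - m|) (ball x' (2 * L * r)))).
    by apply: mint_subset => //; exact: borel_ball.
  apply: le_trans hm _; rewrite (mulrC (C ^+ k)) -[M * _ * _]mulrA; apply: ler_wpM2l => //.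
  apply: (vol_ball_le fmu dC) => //.
  apply: (@le_trans _ _ (3 * L * r)).
    by rewrite (_ : 3 * L * r = L * r + 2 * L * r) ?lerD2r ?ltW//; ring.
  by rewrite mulrA; apply: ler_wpM2r; [exact: ltW|rewrite -ler_pdivrMr].
have kx : `|v x' - m| <= K * (s' * r) + C ^+ k * M.
  by apply: key; rewrite mdistxx mulr_gt0.
have ky := key y' xy'.
have -> : w x - w y = v x' - v y'.
  rewrite !hv; [|rewrite /R1|by rewrite mdistxx ltW].
    by rewrite fx' fy'; ring.
  apply: ltW; apply: lt_trans xy' _.
  rewrite (_ : 2 * L * r = L * r + L * r); last by ring.
  by rewrite -addrA ltrDl addr_gt0// mulr_gt0.
have hK : 2 * (K * (s' * r)) <= A * s * r.
  rewrite /K (_ : 2 * _ = A * (s' * (2 * L)) * r); last by ring.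
  apply: ler_wpM2r; first exact: ltW.
  apply: ler_wpM2l => //; rewrite -ler_pdivlMr ?mulr_gt0//.
  by rewrite ge_min lexx.
have -> : 2 * (C ^+ k * (Cp * (2 * (2 * L)) * b0)) * a * r = 2 * (C ^+ k * M).
  by rewrite ME; ring.
rewrite (_ : v x' - v y' = (v x' - m) - (v y' - m)); last by ring.
apply: le_trans (ler_normB _ _) _; apply: le_trans (lerD kx ky) _.
rewrite [leLHS](_ : _ = 2 * (K * (s' * r)) + 2 * (C ^+ k * M)); last by ring.
by rewrite lerD2r.
Qed.

End lift.

(** * Chains *)

Section powers.
Context {R : realType}.
Implicit Types a b p q t : R.

Lemma powR_add_le a b p : 0 <= a -> 0 <= b -> 0 <= p ->
  (a + b) `^ p <= (2 * a) `^ p + (2 * b) `^ p.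
Proof.
move=> a0 b0 p0.
have h c d : 0 <= c -> c <= d -> (c + d) `^ p <= (2 * d) `^ p.
  by move=> c0 cd; apply: ge0_ler_powR; rewrite ?nnegrE//; lra.
have [ab|ba] := leP a b.
  by apply: le_trans (h _ _ a0 ab) _; rewrite lerDr powR_ge0.
by rewrite addrC; apply: le_trans (h _ _ b0 (ltW ba)) _; rewrite lerDl powR_ge0.
Qed.

(** A split at the threshold t, which stands in for Hölder's inequality when averages of q-th powers
    have to control averages of p-th powers. *)
Lemma powR_young g t p q : 0 <= g -> 0 < t -> 0 <= p -> p <= q ->
  g `^ p <= t `^ p + t `^ p / t `^ q * g `^ q.
Proof.
move=> g0 t0 p0 pq.
have [gt|tg] := leP g t.
  apply: (@le_trans _ _ (t `^ p)).
    by apply: ge0_ler_powR; rewrite ?nnegrE// ltW.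
  by rewrite lerDl !mulr_ge0 ?invr_ge0 ?powR_ge0.
apply: (@le_trans _ _ (t `^ p / t `^ q * g `^ q)); last by rewrite lerDr powR_ge0.
have [s gE s1] : exists2 s, g = t * s & 1 <= s.
  exists (g / t); first by field; rewrite gt_eqF.
  by rewrite ler_pdivlMr// mul1r ltW.
have s0 : 0 <= s by exact: le_trans ler01 s1.
rewrite gE !powRM ?(ltW t0)// mulrA divfK ?gt_eqF ?powR_gt0//.
by apply: ler_wpM2l; [exact: powR_ge0|exact: ler_powR].
Qed.

Lemma powR_quarter a p : 0 <= a -> 1 <= p -> (a / 4) `^ p <= a `^ p / 4.
Proof.
move=> a0 p1; rewrite powRM// ?invr_ge0//; apply: ler_wpM2l; first exact: powR_ge0.
have h : 0 < (4^-1 : R) <= 1 by rewrite invr_gt0 invf_le1//; lra.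
exact: ge1r_powR.
Qed.

Lemma powR2_ge a : exists q0, forall q, q0 <= q -> a <= 2 `^ q.
Proof.
have [k hk] := exp2_ge a; exists k%:R => q kq; apply: le_trans hk _.
by rewrite -powR_mulrn//; apply: ler_powR => //; lra.
Qed.

End powers.

Section core.
Context {R : realType} {Y : pmetricType R}.
Variable nu : {measure set (borelType Y) -> \bar R}.
Variables (C p : R).
Hypothesis fnu : finite_on_balls nu.
Hypothesis dC : doubling_cst nu C.
Hypothesis inu : inner_regular nu.
Hypothesis p1 : 1 <= p.

Let C1 : 1 <= C. Proof. by case: dC. Qed.
Let C0 : 0 < C. Proof. exact: lt_le_trans ltr01 C1. Qed.
Let p0 : 0 < p. Proof. exact: lt_le_trans ltr01 p1. Qed.

(** Connectedness at every scale within a dilated ball. The number of links is not controlled here;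
    [chain_osc] recovers a bound from doubling. *)
Definition chain_connected Th := forall (x y : Y) r e, mdist x y < r -> 0 < e ->
  exists q : seq Y, [/\ path (fun a b => mdist a b < e) x q, last x q = y &
    all (fun z => mdist x z < Th * r) q].

(* Otherwise the indicator of the set reached by chains from x would be locally
   constant on the ball, contradicting the inequality. *)
Lemma two_point_poincare_chain : two_point_poincare nu p ->
  exists2 Th, 1 <= Th & chain_connected Th.
Proof.
move=> [Lam Lam0 hP]; exists (Lam + 1); first lra.
move=> x y r e xy e0; have r0 : 0 < r by apply: le_lt_trans xy; exact: mdist_ge0.
pose Q z q := [/\ path (fun a b : Y => mdist a b < e) x q, last x q = z &
    all (fun z => mdist x z < (Lam + 1) * r) q].
apply: contrapT => noq.
pose S : set Y := [set z | exists q, Q z q].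
have Thr : 0 < (Lam + 1) * r by rewrite mulr_gt0//; lra.
pose F := ball x ((Lam + 1) * r).
have Sx : S x by exists [::].
have Sy : ~ S y by [].
have step a b : S a -> F b -> mdist a b < e -> S b.
  move=> [q [qp ql qa]]; rewrite /F mem_ball => Fb ab; exists (rcons q b); split.
  - by rewrite rcons_path qp ql.
  - by rewrite last_rcons.
  - by rewrite all_rcons Fb.
pose u z : R := \1_S z.
have uE a b : F a -> F b -> mdist a b < e -> u a = u b.
  move=> Fa Fb ab; rewrite /u !indicE; congr (_%:R); congr nat_of_bool.
  apply/idP/idP; rewrite !inE => /step; apply => //.
  by rewrite metric_sym.
(* On F the indicator u jumps only between points at distance at least e, hence is Lipschitz with
   constant [e^-1]. *)
have [|||w we wu] := @mcshane _ _ F u e^-1.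
- by exists x; exact: ball_ctr.
- by rewrite invr_ge0 ltW.
- move=> a b Fa Fb; have [ab|ab] := ltP (mdist a b) e.
    rewrite (uE a b)// subrr normr0 mulr_ge0 ?mdist_ge0//.
    by rewrite invr_ge0 ltW.
  apply: (@le_trans _ _ 1); last by rewrite mulrC ler_pdivlMr// mul1r.
  by rewrite /u !indicE; do 2 case: (_ \in _); rewrite /= ler_norml; lra.
have e1 : 0 <= e^-1 by rewrite invr_ge0 ltW.
have gw z : F z -> glip w z = 0.
  move=> Fz; apply/eqP; rewrite eq_le glip_ge0 andbT.
  apply/(glip_leP _ e1 we (lexx 0)) => e' e'0.
  exists (Num.min e ((Lam + 1) * r - mdist x z)).
    by rewrite lt_min e0 subr_gt0; move: Fz; rewrite /F mem_ball.
  move=> z'; rewrite lt_min => /andP[z1 z2].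
  have Fz' : F z' by rewrite /F mem_ball; have := metric_triangle x z z'; lra.
  rewrite !wu// (uE z z')// subrr normr0 mulr_ge0 ?mdist_ge0//; lra.
(* This s and the a below make each error term equal to 1/4, whereas u differs by 1 between x and
   y. *)
have s0 : 0 < e / (4 * r) by rewrite divr_gt0// mulr_gt0.
have [Cs Cs0 hs] := hP _ s0.
pose a := (4 * Cs * r)^-1.
have a0 : 0 < a by rewrite invr_gt0 !mulr_gt0.
have LF : ball x (Lam * r) `<=` F.
  by apply: sub_ball; rewrite mdistxx; lra.
have ha : mint nu (fun z => glip w z `^ p) (ball x (Lam * r)) <=
    a `^ p * vol nu (ball x (Lam * r)).
  apply: (@le_trans _ _ (mint nu (fun=> 0) (ball x (Lam * r)))).
    apply: le_mint => //.
    - by apply: adm_powR (ltW p0) (adm_glip e1 we).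
    - exact: adm_cst.
    - exact: borel_ball.
    - by move=> z /LF/gw ->; rewrite powR0// gt_eqF.
  rewrite mint_cst; last exact: borel_ball.
  by rewrite mul0r mulr_ge0 ?powR_ge0 ?vol_ge0.
have := hs w e^-1 x y r a r0 e1 a0 we xy ha.
have Fx : F x by exact: ball_ctr.
have Fy : F y by rewrite /F mem_ball; apply: lt_trans xy _; rewrite ltr_pMl//; lra.
rewrite !wu// /u !indicE mem_set// memNset//=.
have -> : e^-1 * (e / (4 * r)) * r = 4^-1 by field; rewrite !gt_eqF.
have -> : Cs * a * r = 4^-1 by rewrite /a; field; rewrite !gt_eqF.
by rewrite subr0 normr1; lra.
Qed.

Lemma path_osc (T : eqType) (e : rel T) (D : pred T) (g : T -> R) l a q :
  (forall b c, D b -> D c -> e b c -> `|g b - g c| <= l) ->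
  D a -> all D q -> path e a q -> `|g a - g (last a q)| <= (size q)%:R * l.
Proof.
move=> he; elim: q a => [|b q IH] a Da /=; first by rewrite subrr normr0 mul0r.
move=> /andP[Db Dq] /andP[ab pq].
have h1 := he _ _ Da Db ab; have h2 := IH b Db Dq pq.
rewrite (_ : g a - _ = (g a - g b) + (g b - g (last b q))); last by ring.
rewrite -add1n natrD mulrDl mul1r.
by apply: le_trans (ler_normD _ _) _; exact: lerD.
Qed.

(** The chain is projected to a net with at most [C ^+ k] points and its loops are removed, so its
    length no longer depends on the original chain. The additional 2 accounts for the end points. *)
Lemma chain_osc Th k : 1 <= Th -> chain_connected Th ->
  forall (F : set Y) (u : Y -> R) x r e l, 0 < r -> 0 < e -> 0 <= l ->
  4 * (Th * r) + 2 * e <= 2 ^+ k * e ->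
  (forall v, mdist x v < Th * r -> exists2 v', F v' & mdist v v' < e) ->
  (forall a b, F a -> F b -> mdist a b < 5 * e -> `|u a - u b| <= l) ->
  F x -> forall z, F z -> mdist x z < r -> `|u x - u z| <= (C ^+ k + 2) * l.
Proof.
move=> Th1 cc F u x r e l r0 e0 l0 hk dF uF Fx z Fz xz.
have [T [Tx sT Tc]] := finite_net fnu dC x e0 hk.
have /choice[phi hphi] : forall v, exists v',
    mdist x v < Th * r -> F v' /\ mdist v v' < e.
  move=> v; have [/dF[v' ? ?]|h] := pselect (mdist x v < Th * r); first by exists v'.
  by exists v.
have /choice[tau htau] : forall v, exists v',
    mdist x v < Th * r -> v' \in T /\ mdist v v' < e.
  move=> v; have [/Tc[v' ? ?]|h] := pselect (mdist x v < Th * r); first by exists v'.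
  by exists v.
have Thr : r <= Th * r by rewrite ler_pMl.
have xx : mdist x x < Th * r by rewrite mdistxx; lra.
have xz' : mdist x z < Th * r by lra.
have [q [pq lq aq]] := cc x z r e xz e0.
(* Projecting to the net moves each end of a link by less than e; moving on to F by [phi] does so
   again, whence the [5 * e] in the hypothesis on u. *)
have pT : path (fun a b => mdist a b < 3 * e) (tau x) (map tau q).
  have tp a q0 : mdist x a < Th * r -> path (fun a b => mdist a b < e) a q0 ->
      all (fun z => mdist x z < Th * r) q0 ->
      path (fun a b => mdist a b < 3 * e) (tau a) (map tau q0).
    elim: q0 a => //= b q0 IH a xa /andP[ab pq0] /andP[xb aq0].
    apply/andP; split; last exact: IH.
    have [_ h1] := htau _ xa; have [_ h2] := htau _ xb.
    have := metric_triangle (tau a) a (tau b); have := metric_triangle a b (tau b).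
    by rewrite (metric_sym (tau a) a); lra.
  exact: tp.
have lT : last (tau x) (map tau q) = tau z by rewrite last_map lq.
have qT : {subset map tau q <= T}.
  by move=> _ /mapP[v /(allP aq) xv ->]; have [] := htau _ xv.
move: lT; case: (shortenP pT) => q' pq' uq' sq' lT.
have [xT xtx] := htau _ xx; have [zT ztz] := htau _ xz'.
have q'T : {subset tau x :: q' <= T}.
  by move=> v; rewrite inE => /predU1P[->//|/sq']; exact: qT.
have sq'T : (size q')%:R <= C ^+ k.
  apply: le_trans sT; rewrite ler_nat; apply: leq_trans (uniq_leq_size uq' q'T).
  by [].
have h1 : `|u (phi (tau x)) - u (phi (tau z))| <= (size q')%:R * l.
  rewrite -lT.
  apply: (@path_osc Y _ (mem T) (u \o phi) l _ _ _ _ _ pq') => //=; last first.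
    by apply/allP => v vq; apply: q'T; rewrite inE vq orbT.
  move=> b c bT cT bc; have [Fb bb] := hphi _ (Tx _ bT).
  have [Fc c'c] := hphi _ (Tx _ cT); apply: uF => //.
  have := metric_triangle (phi b) b (phi c); have := metric_triangle b c (phi c).
  by rewrite (metric_sym (phi b) b); lra.
have end_osc v : F v -> tau v \in T -> mdist v (tau v) < e ->
    `|u v - u (phi (tau v))| <= l.
  move=> Fv vT vtv; have [Fb bb] := hphi _ (Tx _ vT); apply: uF => //.
  have := metric_triangle v (tau v) (phi (tau v)); lra.
have h2 := end_osc _ Fx xT xtx; have h3 := end_osc _ Fz zT ztz.
have h4 : (size q')%:R * l <= C ^+ k * l by apply: ler_wpM2r.
rewrite (_ : u x - u z = (u x - u (phi (tau x))) +
  ((u (phi (tau x)) - u (phi (tau z))) - (u z - u (phi (tau z))))); last by ring.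
apply: le_trans (ler_normD _ _) _.
have := ler_normB (u (phi (tau x)) - u (phi (tau z))) (u z - u (phi (tau z))).
rewrite mulrDl; lra.
Qed.

End core.

(** * Maximal function argument *)

Section step.
Context {R : realType} {Y : pmetricType R}.
Variable nu : {measure set (borelType Y) -> \bar R}.
Variables (C p : R).
Hypothesis fnu : finite_on_balls nu.
Hypothesis dC : doubling_cst nu C.
Hypothesis inu : inner_regular nu.
Hypothesis p1 : 1 <= p.

(** The uncentred maximal function of h, with radii up to rho, is at most lam at z. *)
Definition good (h : Y -> R) rho lam (z : Y) := forall v t, 0 < t -> t <= rho ->
  mdist v z < t -> mint nu h (ball v t) <= lam * vol nu (ball v t).

(** The bound on the centres admits every ball of radius at most rho that meets [ball x r], and
    keeps the union inside [ball x (r + 2 * rho)]. *)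
Definition bad_family (h : Y -> R) rho lam x r := [set i : Y * R |
  [/\ 0 < i.2, i.2 <= rho, mdist x i.1 < r + rho &
      lam * vol nu (pball i) < mint nu h (pball i)]].

Definition bad h rho lam x r : set Y := \bigcup_(i in bad_family h rho lam x r) pball i.

Lemma bad_open h rho lam x r : open (bad h rho lam x r).
Proof. by apply: bigcup_open => i _; exact: open_mball. Qed.

Lemma notbad_good h rho lam x r z : mdist x z < r -> ~ bad h rho lam x r z ->
  good h rho lam z.
Proof.
move=> xz nb v t t0 trho vz; rewrite leNgt; apply/negP => hb; apply: nb.
exists (v, t); last by rewrite /pball mem_ball.
split => //=; have := metric_triangle x z v; rewrite (metric_sym z v); lra.
Qed.

Lemma good_notbad h rho lam x r z : good h rho lam z -> ~ bad h rho lam x r z.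
Proof.
move=> gz [[v t] [/= t0 trho _]]; rewrite /pball mem_ball/= => hb vz.
by have := gz v t t0 trho vz; rewrite leNgt hb.
Qed.

(** Localised weak type (1,1) bound for the maximal function. *)
Lemma bad_measure h rho lam x r : adm h -> 0 < lam ->
  (nu (bad h rho lam x r) <=
    (C ^+ 2 * (mint nu h (ball x (r + 2 * rho)) / lam))%:E)%E.
Proof.
move=> ah lam0; apply: (vitali_cover fnu dC inu) => [i []//|s us sF ts].
rewrite ler_pdivlMr//.
apply: (@le_trans _ _ (\sum_(i <- s) mint nu h (pball i))).
  rewrite mulr_suml big_seq [leRHS]big_seq; apply: ler_sum => i /sF[_ _ _ hb].
  by rewrite mulrC ltW.
apply: sum_mint_le => //.
- by move=> i; exact: borel_ball.
- exact: borel_ball.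
- move=> i /sF[i0 irho xi _]; apply: sub_ball.
  by rewrite metric_sym; lra.
Qed.

Definition dilated (E : set Y) c : set Y :=
  \bigcup_(i in [set i : Y * R | 0 < i.2 /\ ball i.1 (c * i.2) `<=` E]) pball i.

Lemma dilated_open E c : open (dilated E c).
Proof. by apply: bigcup_open => i _; exact: open_mball. Qed.

Lemma dilated_measure E k : measurable (E : set (borelType Y)) -> (nu E < +oo)%E ->
  (nu (dilated E (2 ^+ k)^-1) <= (C ^+ 2 * (C ^+ k * vol nu E))%:E)%E.
Proof.
move=> mE fE.
have c0 : 0 < (2 ^+ k)^-1 :> R by rewrite invr_gt0 exprn_gt0.
have c1 : (2 ^+ k)^-1 <= 1 :> R by rewrite invf_le1 ?exprn_gt0// exprn_ege1//; lra.
have C1 : 0 <= C by have [? _] := dC; lra.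
apply: (vitali_cover fnu dC inu) => [i []//|s us sF ts].
have h1 : \sum_(i <- s) vol nu (ball i.1 ((2 ^+ k)^-1 * i.2)) <= vol nu E.
  apply: sum_vol_le => //.
  - by move=> i; exact: borel_ball.
  - move=> i j /= si sj [z [iz jz]]; apply: ts => //; exists z.
    have [i0 _] := sF _ si; have [j0 _] := sF _ sj.
    split; [move: iz|move: jz]; apply: sub_ball; rewrite mdistxx add0r.
      by rewrite ler_piMl// ltW.
    by rewrite ler_piMl// ltW.
  - by move=> i /sF[].
apply: (@le_trans _ _ (C ^+ k * \sum_(i <- s) vol nu (ball i.1 ((2 ^+ k)^-1 * i.2)))).
  rewrite mulr_sumr big_seq [leRHS]big_seq; apply: ler_sum => i /sF[i0 _].
  apply: (vol_ball_le fnu dC); first by rewrite mulr_gt0.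
  by rewrite mdistxx add0r mulrA mulfV ?mul1r// expf_neq0.
by apply: ler_wpM2l => //; exact: exprn_ge0.
Qed.

(* [dilated E c] contains the points where the complement of E is c-porous.
   Excluding them replaces the Lebesgue density theorem, at the price of an error
   of order c. *)
Lemma glip_extension u w K A (E : set Y) c d z : 0 <= K -> lipk K u ->
  0 <= A -> lipk A w -> 0 < c -> c <= 1 -> 0 < d ->
  (forall z', mdist z z' < d -> ~ E z' -> w z' = u z') -> ~ E z ->
  ~ dilated E c z -> glip w z <= 3 * glip u z + 2 * A * c.
Proof.
move=> K0 uK A0 wA c0 c1 d0 wu Ez Dz.
have g0 := glip_ge0 u z; set g := glip u z in g0 *.
apply/(glip_leP _ A0 wA); first by rewrite addr_ge0 ?mulr_ge0// ltW.
move=> e e0.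
have [t t0 ht] := (glip_leP z K0 uK g0).1 (lexx _) (e / 3) (divr_gt0 e0 (ltr0Sn _ _)).
exists (Num.min (t / 3) (d / 3)); first by rewrite lt_min !divr_gt0.
move=> v; rewrite lt_min => /andP[zv1 zv2].
have [->|zv] := eqVneq z v; first by rewrite subrr normr0 mdistxx mulr0.
have m0 : 0 < mdist z v by rewrite mdist_gt0.
(* Otherwise [ball v (2 * mdist z v)], which contains z, would have its c-shrinking inside E and put
   z into [dilated E c]. *)
have [v' [vv' Ev']] : exists v', mdist v v' < 2 * c * mdist z v /\ ~ E v'.
  apply: contrapT => h; apply: Dz; exists (v, 2 * mdist z v); last first.
    by rewrite /pball mem_ball/= metric_sym ltr_pMl//; lra.
  split => /=; first by rewrite mulr_gt0.
  move=> v'; rewrite mem_ball => vv'; apply: contrapT => Ev'; apply: h.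
  by exists v'; split => //; rewrite (mulrC 2) -mulrA.
have cm : c * mdist z v <= mdist z v by rewrite ler_piMl// ltW.
have zv' : mdist z v' <= 3 * mdist z v.
  have := metric_triangle z v v'; rewrite -mulrA in vv'; lra.
have h1 : `|w v - w v'| <= A * (2 * c * mdist z v).
  by apply: le_trans (wA _ _) _; apply: ler_wpM2l => //; exact: ltW.
have h2 : `|w v' - w z| <= (g + e / 3) * (3 * mdist z v).
  rewrite (wu z)//; last by rewrite mdistxx.
  rewrite (wu v')//; last by lra.
  apply: le_trans (ht _ _) _; first by lra.
  by apply: ler_wpM2l => //; lra.
rewrite (_ : w v - w z = (w v - w v') + (w v' - w z)); last by ring.
apply: le_trans (ler_normD _ _) _; apply: le_trans (lerD h1 h2) _.
by rewrite le_eqVlt; apply/orP; left; apply/eqP; field.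
Qed.

(** The statement propagated by the descent in tau; [Cst] has to stay the same at every level. *)
Definition osc_bound Lam1 Cst q (u : Y -> R) tau := forall x y r, 0 < r ->
  mdist x y < r -> good (fun z => glip u z `^ q) (Lam1 * r) (tau `^ q) x ->
  good (fun z => glip u z `^ q) (Lam1 * r) (tau `^ q) y ->
  `|u x - u y| <= Cst * tau * r.

Lemma osc_bound_big Lam1 Cst q u K tau : 0 <= K -> lipk K u -> K <= Cst * tau ->
  osc_bound Lam1 Cst q u tau.
Proof.
move=> K0 uK Kt x y r r0 xy _ _; apply: le_trans (uK x y) _.
by apply: ler_pM => //; rewrite ?mdist_ge0// ltW.
Qed.

(** On [E'] the trivial bound A is used. Elsewhere the p-th power of the sum is split, giving 6 as
    twice 3, and [powR_young] at threshold tau yields two equal contributions, hence the factor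
    2. *)
Lemma extension_energy u K w A (E' : set Y) x r q tau g1 : 0 <= K -> lipk K u ->
  0 <= A -> lipk A w -> 0 < tau -> p <= q -> 0 <= g1 ->
  measurable (E' : set (borelType Y)) -> (nu E' < +oo)%E ->
  mint nu (fun z => glip u z `^ q) (ball x r) <= tau `^ q * vol nu (ball x r) ->
  (forall z, mdist x z < r -> ~ E' z -> glip w z <= 3 * glip u z + g1) ->
  mint nu (fun z => glip w z `^ p) (ball x r) <=
    (2 * (6 * tau) `^ p + (2 * g1) `^ p) * vol nu (ball x r) + A `^ p * vol nu E'.
Proof.
move=> K0 uK A0 wA tau0 pq g10 mE' fE' hu hw.
have p0 : 0 < p by exact: lt_le_trans ltr01 p1.
have q0 : 0 <= q by apply: le_trans pq; exact: ltW.
pose h z := glip u z `^ q.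
have ah : adm h by apply: adm_powR q0 (adm_glip K0 uK).
have hE z : h z = glip u z `^ q by [].
have {}hu : mint nu h (ball x r) <= tau `^ q * vol nu (ball x r) := hu.
clearbody h.
pose c1 := (6 * tau) `^ p + (2 * g1) `^ p.
pose c2 := (6 * tau) `^ p / tau `^ q.
have c10 : 0 <= c1 by rewrite addr_ge0 ?powR_ge0.
have c20 : 0 <= c2 by rewrite divr_ge0 ?powR_ge0.
have Ap0 : 0 <= A `^ p by exact: powR_ge0.
have mB : measurable (ball x r : set (borelType Y)) by exact: borel_ball.
have fB := fnu x r.
have a1 : adm (fun z => c1 + c2 * h z) by apply: admD; [exact: adm_cst|exact: admZ].
have a2 : adm (fun z => A `^ p * \1_E' z) by apply: admZ => //; exact: adm_indic.
apply: (@le_trans _ _ (mint nu (fun z => (c1 + c2 * h z) + A `^ p * \1_E' z) (ball x r))).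
  apply: (le_mint (adm_powR (ltW p0) (adm_glip A0 wA)) (admD a1 a2) mB fB).
  move=> z; rewrite mem_ball => xz.
  have [E'z|E'z] := pselect (E' z).
    rewrite indicE mem_set// mulr1.
    apply: (@le_trans _ _ (A `^ p)).
      apply: (ge0_ler_powR (ltW p0)); rewrite ?nnegrE ?glip_ge0//.
      exact: glip_le_lipk wA.
    by rewrite lerDr addr_ge0// mulr_ge0//; have [_ h0 _] := ah; exact: h0.
  rewrite indicE memNset// mulr0 addr0.
  have gu0 := glip_ge0 u z.
  have g30 : 0 <= 3 * glip u z by rewrite mulr_ge0.
  apply: (@le_trans _ _ ((3 * glip u z + g1) `^ p)).
    apply: (ge0_ler_powR (ltW p0)); rewrite ?nnegrE ?glip_ge0//.
      by rewrite addr_ge0.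
    exact: hw.
  apply: le_trans (powR_add_le g30 g10 (ltW p0)) _.
  rewrite /c1 addrAC lerD2r mulrA (_ : 2 * 3 = 6); last by ring.
  rewrite powRM// /c2 (powRM p _ (ltW tau0))// -!mulrA -mulrDr.
  apply: ler_wpM2l; first exact: powR_ge0.
  by rewrite mulrA hE; apply: powR_young => //; exact: ltW.
rewrite mintD// mintZ//; last exact: adm_indic.
rewrite mintD//; [|exact: adm_cst|exact: admZ].
rewrite mint_cst// mintZ// mint_indic//.
apply: lerD; last first.
  apply: ler_wpM2l => //; apply: le_vol => //.
  exact: measurableI.
apply: (@le_trans _ _ (c1 * vol nu (ball x r) + c2 * (tau `^ q * vol nu (ball x r)))).
  by rewrite lerD2l; apply: ler_wpM2l.
rewrite mulrA /c2 divfK ?gt_eqF ?powR_gt0// -mulrDl /c1.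
apply: ler_wpM2r; first exact: vol_ge0.
by rewrite le_eqVlt; apply/orP; left; apply/eqP; ring.
Qed.

End step.

(** * The bootstrap from level 2 tau to level tau *)

Section osc_step.
Context {R : realType} {Y : pmetricType R}.
Variable nu : {measure set (borelType Y) -> \bar R}.
Variables (C p : R).
Hypothesis fnu : finite_on_balls nu.
Hypothesis dC : doubling_cst nu C.
Hypothesis inu : inner_regular nu.
Hypothesis p1 : 1 <= p.
(* The constants are chosen in the order Th, Lam1, N, Cs, Cst, c, q. *)
Variables (Th Lam Lam1 N Cs b Cst c q : R) (k1 k2 k3 kc : nat).
Hypothesis Th1 : 1 <= Th.
Hypothesis cc : chain_connected (Y := Y) Th.
Hypothesis Lam0 : 0 < Lam.
Hypothesis Lam1E : Lam1 = 2 * (Th * (Lam + 1) + 1).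
Hypothesis hk1 : 4 * (Th * (Lam + 1)) * 40 + 2 <= 2 ^+ k1.
Hypothesis NE : N = C ^+ k1 + 2.
Hypothesis hk2 : (Th * (Lam + 1) + Lam1) * 40 <= 2 ^+ k2.
Hypothesis hk3 : Lam1 <= 2 ^+ k3 * Lam.
Hypothesis Cs0 : 0 < Cs.
Hypothesis hP : forall (w : Y -> R) A x y r a, 0 < r -> 0 <= A -> 0 < a -> lipk A w ->
    mdist x y < r ->
    mint nu (fun z => glip w z `^ p) (ball x (Lam * r)) <=
      a `^ p * vol nu (ball x (Lam * r)) ->
    `|w x - w y| <= A * (8 * N)^-1 * r + Cs * a * r.
Hypothesis bE : b = (2 * Cs)^-1.
Hypothesis CstE : Cst = 24 / b.
Hypothesis cE : c = (2 ^+ kc)^-1.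
Hypothesis hkc : 64 * N / b <= 2 ^+ kc.
Hypothesis pq : p <= q.
Hypothesis hq1 : C ^+ 2 * C ^+ k2 * 2 <= 2 `^ q.
Hypothesis hq2 : 4 * (4 * N / b) `^ p * (C ^+ 2 * C ^+ kc * C ^+ 2 * C ^+ k3) <= 2 `^ q.

Let C1 : 1 <= C. Proof. by case: dC. Qed.
Let C0 : 0 < C. Proof. exact: lt_le_trans ltr01 C1. Qed.
Let p0 : 0 < p. Proof. exact: lt_le_trans ltr01 p1. Qed.
Let q0 : 0 <= q. Proof. by apply: le_trans pq; exact: ltW. Qed.
Let N1 : 2 <= N. Proof. by rewrite NE lerDr exprn_ge0// ltW. Qed.
Let N0 : 0 < N. Proof. exact: lt_le_trans (ltr0Sn _ 1) N1. Qed.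
Let N1' : 1 <= N. Proof. by apply: le_trans N1; rewrite ler1n. Qed.
Let Th0 : 0 < Th. Proof. exact: lt_le_trans ltr01 Th1. Qed.
Let b0 : 0 < b. Proof. by rewrite bE invr_gt0 mulr_gt0. Qed.
Let Cst0 : 0 < Cst. Proof. by rewrite CstE divr_gt0. Qed.
Let c0 : 0 < c. Proof. by rewrite cE invr_gt0 exprn_gt0. Qed.
Let c1 : c <= 1.
Proof. by rewrite cE invf_le1 ?exprn_gt0// exprn_ege1//; lra. Qed.
Let ThL : 1 <= Th * (Lam + 1).
Proof. by rewrite mulr_ege1// lerDr ltW. Qed.
Let ThL' : Lam + 1 <= Th * (Lam + 1).
Proof. by rewrite ler_peMl// addr_ge0 ?ltW. Qed.
Let Lam10 : 0 < Lam1.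
Proof. by have h := ThL; rewrite Lam1E; lra. Qed.

Lemma good_le (h : Y -> R) rho rho' lam lam' z : rho' <= rho -> lam <= lam' ->
  good nu h rho lam z -> good nu h rho' lam' z.
Proof.
move=> rr ll gz v t t0 tr vz; apply: le_trans (gz v t t0 (le_trans tr rr) vz) _.
by apply: ler_wpM2r => //; exact: vol_ge0.
Qed.

Lemma sub_dilated (E : set Y) : open E -> E `<=` dilated E c.
Proof.
move=> oE z Ez.
have /nbhs_ballP[t /= t0 tE] : nbhs z E by apply: open_nbhs_nbhs.
exists (z, t / c); last by apply: ball_ctr; rewrite divr_gt0.
by split; rewrite /= ?divr_gt0// mulrC divfK ?gt_eqF.
Qed.

(** The budget is spent in quarters of [a ^ p]: two on [6 * tau], which equals [a / 4]; one on the
    porosity error, by smallness of c; one on the exceptional set, whose measure carries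
    [2 ^ -q]. *)
Lemma energy_arith tau a A V V1 VE VE' : 0 < tau -> 0 <= V -> 0 <= V1 ->
  A = 4 * N * Cst * tau -> a = b * Cst * tau ->
  V1 <= C ^+ k3 * V -> VE <= C ^+ 2 * (V1 / 2 `^ q) ->
  VE' <= C ^+ 2 * (C ^+ kc * VE) ->
  (2 * (6 * tau) `^ p + (2 * (2 * A * c)) `^ p) * V + A `^ p * VE' <= a `^ p * V.
Proof.
move=> tau0 V0 V10 AE aE hV1 hVE hVE'.
have a0 : 0 <= a by rewrite aE !mulr_ge0// ltW.
have A0 : 0 <= A by rewrite AE !mulr_ge0// ltW.
have ap0 : 0 <= a `^ p by exact: powR_ge0.
have aq := powR_quarter a0 p1.
have h6 : (6 * tau) `^ p <= a `^ p / 4.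
  rewrite (_ : 6 * tau = a / 4)//; rewrite aE CstE; field.
  by rewrite gt_eqF.
have h4 : (2 * (2 * A * c)) `^ p <= a `^ p / 4.
  apply: le_trans aq; apply: (ge0_ler_powR (ltW p0)); rewrite ?nnegrE.
  - by rewrite !mulr_ge0// ltW.
  - by rewrite divr_ge0.
  rewrite (_ : 2 * (2 * A * c) = a / 4 * (64 * N / b * c)); last first.
    rewrite AE aE; field; by rewrite gt_eqF.
  rewrite ler_piMr ?divr_ge0//.
  by rewrite cE ler_pdivrMr ?exprn_gt0// mul1r.
have hA : A `^ p = (4 * N / b) `^ p * a `^ p.
  rewrite -powRM//; last by rewrite divr_ge0 ?(ltW b0)// mulr_ge0// ltW.
  congr (_ `^ _); rewrite AE aE; field; by rewrite gt_eqF.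
have q2 : 0 < 2 `^ q :> R by exact: powR_gt0.
have hE' : VE' <= C ^+ 2 * (C ^+ kc * (C ^+ 2 * (C ^+ k3 * V / 2 `^ q))).
  apply: le_trans hVE' _; apply: ler_wpM2l; first by rewrite exprn_ge0// ltW.
  apply: ler_wpM2l; first by rewrite exprn_ge0// ltW.
  apply: le_trans hVE _; apply: ler_wpM2l; first by rewrite exprn_ge0// ltW.
  by apply: ler_wpM2r; rewrite // invr_ge0 ltW.
have hAE : A `^ p * VE' <= a `^ p / 4 * V.
  apply: (@le_trans _ _ (A `^ p *
     (C ^+ 2 * (C ^+ kc * (C ^+ 2 * (C ^+ k3 * V / 2 `^ q)))))).
    by apply: ler_wpM2l => //; exact: powR_ge0.
  rewrite hA (_ : _ * _ = (4 * (4 * N / b) `^ p *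
     (C ^+ 2 * C ^+ kc * C ^+ 2 * C ^+ k3)) / 2 `^ q * (a `^ p / 4 * V)); last first.
    field; by rewrite gt_eqF.
  apply: ler_piMl; first by rewrite mulr_ge0// divr_ge0.
  by rewrite ler_pdivrMr// mul1r.
have : (2 * (6 * tau) `^ p + (2 * (2 * A * c)) `^ p) * V <= 3 * (a `^ p / 4) * V.
  by apply: ler_wpM2r => //; lra.
have -> : a `^ p * V = 3 * (a `^ p / 4) * V + a `^ p / 4 * V by field.
by move=> h; exact: lerD.
Qed.

(* E is the superlevel set of the maximal function of [glip u ^ q] at height
   [(2 tau)^q]. Off E the function u is Lipschitz with constant A of order tau, by
   the bound at level [2 tau] and chaining; its extension w has small energy
   because the measure of E carries the factor [2^-q]. *)
Lemma osc_step u K tau : 0 <= K -> lipk K u -> 0 < tau ->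
  osc_bound nu Lam1 Cst q u (2 * tau) -> osc_bound nu Lam1 Cst q u tau.
Proof.
move=> K0 uK tau0 H x y r r0 xy; set h := fun z : Y => glip u z `^ q.
move=> gx gy.
have ah : adm h by apply: adm_powR q0 (adm_glip K0 uK).
have tq0 : 0 < tau `^ q by exact: powR_gt0.
have q2 : 0 < 2 `^ q :> R by exact: powR_gt0.
(* R0 leaves room for the chains, R1 is the radius needed to use level [2 * tau] at scales up to
   [r / 4], and [R0 + 2 * R1] is exactly [Lam1 * r], where goodness of x bounds the integral of
   h. *)
have [R0 R0E] : exists R0, R0 = (Th * (Lam + 1) + 1) * r by eexists.
have [R1 R1E] : exists R1, R1 = Lam1 * (r / 4) by eexists.
have [lam lamE] : exists lam, lam = (2 * tau) `^ q by eexists.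
have lamE' : lam = 2 `^ q * tau `^ q by rewrite lamE powRM// ltW.
have lam0 : 0 < lam by rewrite lamE' mulr_gt0.
have R1r : R1 <= Lam1 * r.
  by rewrite R1E; apply: ler_wpM2l; [exact: ltW|lra].
have tl : tau `^ q <= lam.
  rewrite lamE' ler_peMl// ?(ltW tq0)//.
  apply: (@le_trans _ _ (1 `^ q)); first by rewrite powR1.
  by apply: (ge0_ler_powR q0); rewrite ?nnegrE// ler1n.
have L1r : 0 < Lam1 * r by rewrite mulr_gt0.
pose E := bad nu h R1 lam x R0.
have oE : open E by exact: bad_open.
have mE : measurable (E : set (borelType Y)) by exact: borel_open.
have [V1 V1E] : exists V1, V1 = vol nu (ball x (Lam1 * r)) by eexists.
have hx : mint nu h (ball x (Lam1 * r)) <= tau `^ q * V1.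
  by rewrite V1E; apply: gx; rewrite // mdistxx.
have hEe : (nu E <= (C ^+ 2 * (V1 / 2 `^ q))%:E)%E.
  apply: le_trans (bad_measure fnu dC inu R1 x R0 ah lam0) _.
  rewrite lee_fin; apply: ler_wpM2l; first by rewrite exprn_ge0// ltW.
  have -> : R0 + 2 * R1 = Lam1 * r by rewrite R0E R1E Lam1E; field.
  rewrite lamE' ler_pdivrMr ?mulr_gt0// mulrA divfK ?gt_eqF//.
  by rewrite [leRHS]mulrC.
have fE : (nu E < +oo)%E by apply: le_lt_trans hEe _; exact: ltry.
have hE : vol nu E <= C ^+ 2 * (V1 / 2 `^ q) by exact: vol_leE.
have Ex : ~ E x by apply: good_notbad; exact: good_le gx.
have Ey : ~ E y by apply: good_notbad; exact: good_le gy.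
have goodE z : mdist x z < R0 -> ~ E z -> good nu h R1 lam z.
  by move=> xz Ez; exact: notbad_good Ez.
clearbody E.
pose F z := mdist x z < R0 /\ ~ E z.
have R0gt : Th * ((Lam + 1) * r) + r = R0 by rewrite R0E; ring.
have r4 : 0 < r / 4 by rewrite divr_gt0.
have F_osc a a' rho : F a -> F a' -> 0 < rho -> rho <= r / 4 ->
    mdist a a' < rho -> `|u a - u a'| <= 2 * Cst * tau * rho.
  move=> [Fa Ea] [Fa' Ea'] rho0 rr aa'.
  have hr : Lam1 * rho <= R1 by rewrite R1E ler_pM2l.
  have hl : lam <= (2 * tau) `^ q by rewrite lamE.
  have := H a a' rho rho0 aa' (good_le hr hl (goodE _ Fa Ea))
    (good_le hr hl (goodE _ Fa' Ea')).
  by rewrite (mulrCA Cst) !mulrA.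
have e0 : 0 < r / 40 by rewrite divr_gt0.
have er : r / 40 <= r by rewrite ler_pdivrMr// ler_peMr ?(ltW r0)// ler1n.
have V10 : 0 <= V1 by rewrite V1E; exact: vol_ge0.
(* A ball of radius [r / 40] contained in E would have at most half of its own measure, by the
   choice of q in [hq1]. *)
have densF v : mdist x v < Th * ((Lam + 1) * r) -> exists2 v', F v' & mdist v v' < r / 40.
  move=> xv; apply: contrapT => hv.
  have vE : ball v (r / 40) `<=` E.
    move=> v'; rewrite mem_ball => vv'; apply: contrapT => Ev'; apply: hv.
    exists v' => //; split => //; rewrite -R0gt.
    apply: le_lt_trans (metric_triangle x v v') _; apply: ltrD => //.
    exact: lt_le_trans er.
  have h1 : vol nu (ball v (r / 40)) <= vol nu E.
    by apply: le_vol => //; exact: borel_ball.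
  have h2 : V1 <= C ^+ k2 * vol nu (ball v (r / 40)).
    rewrite V1E; apply: (vol_ball_le fnu dC) => //.
    have h3 : (Th * (Lam + 1) + Lam1) * 40 * (r / 40) <= 2 ^+ k2 * (r / 40).
      by rewrite ler_pM2r.
    apply: le_trans h3.
    rewrite (_ : _ * 40 * _ = Th * ((Lam + 1) * r) + Lam1 * r); last by field.
    by rewrite lerD2r ltW.
  have V0 := vol_ball_gt0 dC v e0.
  set W := vol nu (ball v (r / 40)) in h1 h2 V0.
  have h3 : C ^+ 2 * (V1 / 2 `^ q) <= W / 2.
    apply: (@le_trans _ _ (C ^+ 2 * (C ^+ k2 * W / 2 `^ q))).
      apply: ler_wpM2l; first by rewrite exprn_ge0// ltW.
      by apply: ler_wpM2r; rewrite // invr_ge0 ltW.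
    rewrite (_ : C ^+ 2 * _ = (C ^+ 2 * C ^+ k2 * 2) / 2 `^ q * (W / 2)); last first.
      field; by rewrite gt_eqF.
    apply: ler_piMl; first by rewrite divr_ge0// ltW.
    by rewrite ler_pdivrMr// mul1r.
  have := le_trans h1 (le_trans hE h3).
  by rewrite leNgt ltr_pdivrMr// ltr_pMr// ltr1n.
have Fx : F x by split => //; rewrite mdistxx -R0gt addr_gt0// !mulr_gt0// addr_gt0.
have l0 : 0 <= Cst * tau * (r / 4) by rewrite !mulr_ge0// ltW.
have R20 : 0 < (Lam + 1) * r by rewrite mulr_gt0// addr_gt0.
have hk : 4 * (Th * ((Lam + 1) * r)) + 2 * (r / 40) <= 2 ^+ k1 * (r / 40).
  have h3 : (4 * (Th * (Lam + 1)) * 40 + 2) * (r / 40) <= 2 ^+ k1 * (r / 40).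
    by rewrite ler_pM2r.
  by apply: le_trans h3; rewrite le_eqVlt; apply/orP; left; apply/eqP; field.
have F_osc5 a a' : F a -> F a' -> mdist a a' < 5 * (r / 40) ->
    `|u a - u a'| <= Cst * tau * (r / 4).
  move=> Fa Fa' aa'; have h5 : 5 * (r / 40) = r / 8 by field.
  rewrite h5 in aa'.
  have r8 : r / 8 <= r / 4 by rewrite ler_pM2l// lef_pV2 ?posrE// ler_nat.
  have := F_osc a a' (r / 8) Fa Fa' (divr_gt0 r0 (ltr0Sn _ _)) r8 aa'.
  by rewrite (_ : 2 * Cst * tau * (r / 8) = Cst * tau * (r / 4)); last by field.
have F_chain z : F z -> mdist x z < (Lam + 1) * r ->
    `|u x - u z| <= N * (Cst * tau * (r / 4)).
  by rewrite NE; exact: (chain_osc fnu dC Th1 cc R20 e0 l0 hk densF F_osc5 Fx).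
have [A AE] : exists A, A = 4 * N * Cst * tau by eexists.
have A0 : 0 <= A by rewrite AE !mulr_ge0// ltW.
pose F2 z := F z /\ mdist x z < (Lam + 1) * r.
have F2x : F2 x by split => //; rewrite mdistxx.
(* Close points use the bound at scale [2 * mdist a a'], since that scale must strictly exceed the
   distance; distant points are joined through x, and the two chain bounds sum to [A * (r / 8)]. *)
have uA a a' : F2 a -> F2 a' -> `|u a - u a'| <= A * mdist a a'.
  move=> [Fa xa] [Fa' xa'].
  have [->|aa'] := eqVneq a a'; first by rewrite subrr normr0 mdistxx mulr0.
  have d0 : 0 < mdist a a' by rewrite mdist_gt0.
  have [d8|d8] := ltP (mdist a a') (r / 8).
    have h1 : 2 * mdist a a' <= r / 4.
      rewrite (_ : r / 4 = 2 * (r / 8)); last by field.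
      by rewrite ler_pM2l// ltW.
    have h2 : mdist a a' < 2 * mdist a a' by rewrite ltr_pMl// ltr1n.
    apply: le_trans (F_osc _ _ _ Fa Fa' (mulr_gt0 (ltr0Sn _ 1) d0) h1 h2) _.
    rewrite (_ : _ * (2 * _) = 4 * Cst * tau * mdist a a'); last by ring.
    apply: ler_wpM2r; first exact: ltW.
    rewrite AE; apply: ler_wpM2r; first exact: ltW.
    apply: ler_wpM2r; first exact: ltW.
    by rewrite ler_peMr// N1'.
  have h1 := F_chain _ Fa xa; have h2 := F_chain _ Fa' xa'.
  rewrite (_ : u a - u a' = (u x - u a') - (u x - u a)); last by ring.
  apply: le_trans (ler_normB _ _) _; apply: le_trans (lerD h2 h1) _.
  rewrite (_ : _ + _ = A * (r / 8)); last by rewrite AE; field.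
  by apply: ler_wpM2l.
have [w wA wu] := mcshane (ex_intro F2 x F2x) A0 uA.
pose E' := dilated E c.
have oE' : open E' by exact: dilated_open.
have EE' : E `<=` E' by exact: sub_dilated.
have hE'e : (nu E' <= (C ^+ 2 * (C ^+ kc * vol nu E))%:E)%E.
  by rewrite /E' cE; exact: (dilated_measure fnu dC inu).
have fE' : (nu E' < +oo)%E by apply: le_lt_trans hE'e _; exact: ltry.
have hE' : vol nu E' <= C ^+ 2 * (C ^+ kc * vol nu E) by exact: vol_leE.
have R2R0 : (Lam + 1) * r + r <= R0.
  by rewrite -R0gt lerD2r mulrA; apply: ler_wpM2r => //; exact: ltW.
have gw z : mdist x z < Lam * r -> ~ E' z -> glip w z <= 3 * glip u z + 2 * A * c.
  move=> xz Ez; have Ez0 : ~ E z by move=> /EE'.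
  apply: (glip_extension (E := E) K0 uK A0 wA c0 c1 r0) => //.
  move=> z' zz' Ez'.
  have xz' : mdist x z' < (Lam + 1) * r.
    by apply: le_lt_trans (metric_triangle x z z') _; rewrite mulrDl mul1r; exact: ltrD.
  apply: wu; split => //; split => //.
  by apply: lt_le_trans xz' _; apply: le_trans R2R0; rewrite lerDl ltW.
have g10 : 0 <= 2 * A * c by rewrite !mulr_ge0// ltW.
have Lr0 : 0 < Lam * r by rewrite mulr_gt0.
have LL1 : Lam * r <= Lam1 * r.
  apply: ler_wpM2r; first exact: ltW.
  by rewrite Lam1E; have h1 := ThL; have h2 := ThL'; lra.
have huL : mint nu h (ball x (Lam * r)) <= tau `^ q * vol nu (ball x (Lam * r)).
  by apply: gx => //; rewrite mdistxx.
have hw := extension_energy fnu p1 K0 uK A0 wA tau0 pq g10 (borel_open oE') fE' huL gw.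
have [a aE] : exists a, a = b * Cst * tau by eexists.
have a0 : 0 < a by rewrite aE !mulr_gt0.
have hV1 : V1 <= C ^+ k3 * vol nu (ball x (Lam * r)).
  rewrite V1E; apply: (vol_ball_le fnu dC) => //; rewrite mdistxx add0r mulrA.
  by rewrite ler_pM2r.
have hw' := le_trans hw (energy_arith tau0 (vol_ge0 nu (ball x (Lam * r))) V10
  AE aE hV1 hE hE').
have F2y : F2 y.
  have ry : r <= (Lam + 1) * r by rewrite ler_peMl ?(ltW r0)// lerDr ltW.
  have xy2 := lt_le_trans xy ry; split => //; split => //.
  by apply: lt_le_trans xy2 _; apply: le_trans R2R0; rewrite lerDl ltW.
(* Each of the two resulting terms equals half of [Cst * tau * r], so the constant does not grow. *)
have := hP r0 A0 a0 wA xy hw'.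
rewrite !wu// => /le_trans; apply.
rewrite le_eqVlt; apply/orP; left; apply/eqP.
rewrite AE aE bE; field.
by rewrite !gt_eqF.
Qed.

(** The number of halvings depends on u, but the constant is unchanged at each of them. *)
Lemma osc_all u K tau : 0 <= K -> lipk K u -> 0 < tau ->
  osc_bound nu Lam1 Cst q u tau.
Proof.
move=> K0 uK; have [n hn] := exp2_ge (K / (Cst * tau)).
move=> tau0; have {}hn : K <= Cst * (2 ^+ n * tau).
  by rewrite mulrCA -ler_pdivrMr// mulr_gt0.
elim: n tau tau0 hn => [|n IH] tau tau0 hn.
  by apply: osc_bound_big K0 uK _; rewrite expr0 mul1r in hn.
apply: (osc_step K0 uK tau0); apply: IH; first by rewrite mulr_gt0.
by rewrite mulrA -exprSr.
Qed.

End osc_step.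

Section pointwise_to_poincare.
Context {R : realType} {Y : pmetricType R}.
Variable nu : {measure set (borelType Y) -> \bar R}.
Variables (C p : R).
Hypothesis fnu : finite_on_balls nu.
Hypothesis dC : doubling_cst nu C.
Hypothesis inu : inner_regular nu.
Hypothesis p1 : 1 <= p.

(** All constants are fixed before u, and every larger exponent is allowed, so that q can be raised
    again for the integral estimate. *)
Lemma core_osc : two_point_poincare nu p ->
  exists Lam1 Cst q0, [/\ 0 < Lam1, 0 < Cst & forall q, q0 <= q ->
    forall u K tau, 0 <= K -> lipk K u -> 0 < tau -> osc_bound nu Lam1 Cst q u tau].
Proof.
move=> hPP; have [Th Th1 cc] := two_point_poincare_chain fnu p1 hPP.
have [Lam Lam0 hP] := hPP.
pose Lam1 := 2 * (Th * (Lam + 1) + 1).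
have [k1 hk1] := exp2_ge (4 * (Th * (Lam + 1)) * 40 + 2).
pose N := C ^+ k1 + 2.
have [k2 hk2] := exp2_ge ((Th * (Lam + 1) + Lam1) * 40).
have [k3 hk3] := exp2_ge (Lam1 / Lam).
have C0 : 0 <= C by have [C1 _] := dC; exact: le_trans ler01 C1.
have N0 : 0 < 8 * N by rewrite mulr_gt0// ltr_wpDl// exprn_ge0.
have sN : 0 < (8 * N)^-1 by rewrite invr_gt0.
have [Cs Cs0 hs] := hP _ sN.
pose b := (2 * Cs)^-1.
have [kc hkc] := exp2_ge (64 * N / b).
have [q1 hq1] := powR2_ge (C ^+ 2 * C ^+ k2 * 2).
have [q2 hq2] := powR2_ge
  (4 * (4 * N / b) `^ p * (C ^+ 2 * C ^+ kc * C ^+ 2 * C ^+ k3)).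
exists Lam1, (24 / b), (Num.max p (Num.max q1 q2)); split.
- rewrite mulr_gt0// addr_gt0// mulr_gt0//; first exact: lt_le_trans ltr01 Th1.
  by rewrite addr_gt0.
- by rewrite divr_gt0// invr_gt0 mulr_gt0.
move=> q; rewrite !ge_max => /and3P[pq q1q q2q] u K tau K0 uK tau0.
rewrite ler_pdivrMr// in hk3.
exact: (osc_all (Th := Th) (Lam := Lam) (N := N) (Cs := Cs) (b := b)
  (c := (2 ^+ kc)^-1) (k1 := k1) (k2 := k2) (k3 := k3) (kc := kc) fnu dC inu p1 Th1 cc
  Lam0 erefl hk1 erefl hk2 hk3 Cs0 hs erefl erefl erefl hkc pq (hq1 _ q1q) (hq2 _ q2q)
  K0 uK tau0).
Qed.

End pointwise_to_poincare.

(** * From pointwise bounds to the Poincare inequality *)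

Section diameter.
Context {R : realType} {Y : metricType R}.

Lemma mdist_le_diam (x a b : Y) r : ball x r a -> ball x r b ->
  mdist a b <= diam (ball x r).
Proof.
move=> xa xb; apply: ub_le_sup; last by exists a => //; exists b.
exists (2 * r) => _ [c xc [d xd <-]]; move: xc xd; rewrite !mem_ball => xc xd.
have := metric_triangle c x d; rewrite (metric_sym c x); lra.
Qed.

(** Links shorter than [r / 2] cannot jump over an annulus of that width. *)
Lemma path_crossing (x a : Y) r q : mdist x a < r / 2 ->
  path (fun b c : Y => mdist b c < r / 2) a q -> r <= mdist x (last a q) ->
  exists2 v, r / 2 <= mdist x v & mdist x v < r.
Proof.
elim: q a => [|b q IH] a xa /=.
  by move=> _; have := mdist_ge0 x a; lra.
move=> /andP[ab pq]; have [xb|xb] := ltP (mdist x b) (r / 2); first exact: IH.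
by move=> _; exists b => //; have := metric_triangle x a b; lra.
Qed.

End diameter.

Section poincare_from_osc.
Context {R : realType} {Y : pmetricType R}.
Variable nu : {measure set (borelType Y) -> \bar R}.
Variables (C : R).
Hypothesis fnu : finite_on_balls nu.
Hypothesis dC : doubling_cst nu C.
Hypothesis inu : inner_regular nu.

Let C1 : 1 <= C. Proof. by case: dC. Qed.
Let C0 : 0 < C. Proof. exact: lt_le_trans ltr01 C1. Qed.

Lemma diam_ball_ge Th (x y : Y) r : chain_connected (Y := Y) Th -> 0 < r ->
  r <= mdist x y -> r / 2 <= diam (ball x r).
Proof.
move=> cc r0 xy.
have [||q [pq lq _]] := cc x y (mdist x y + 1) (r / 2).
- by rewrite ltrDl.
- by rewrite divr_gt0.
have [||v v1 v2] := @path_crossing _ _ x x r q _ pq.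
- by rewrite mdistxx divr_gt0.
- by rewrite lq.
apply: le_trans v1 _; apply: mdist_le_diam; first exact: ball_ctr.
by rewrite mem_ball.
Qed.

(* The Poincare inequality is stated with the diameter, which may be much smaller
   than the radius when the ball is the whole space. *)
Lemma radius_le_diam Th (x : Y) r D : chain_connected (Y := Y) Th -> 1 <= D ->
  0 < r -> (forall y, y = x) \/
  exists r', [/\ 0 < r', ball x r' = ball x r, ball x (D * r') = ball x (D * r) &
    r' <= 2 * diam (ball x r)].
Proof.
move=> cc D1 r0.
have [[y xy]|far] := pselect (exists y, r <= mdist x y).
  right; exists r; split => //; have := diam_ball_ge cc r0 xy; lra.
have near_ y : ball x r y.
  by rewrite mem_ball ltNge; apply/negP => xy; apply: far; exists y.
have [triv|ntriv] := pselect (forall y, y = x); [by left|right].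
have [y xy] : exists y, y <> x by apply/existsNP.
set d := diam (ball x r).
have xz z : mdist x z <= d by apply: mdist_le_diam => //; exact: ball_ctr.
have d0 : 0 < d.
  by apply: lt_le_trans (xz y); rewrite mdist_gt0; apply/eqP => h; apply: xy.
have [rd|dr] := leP r (2 * d); first by exists r; split.
(* Here the ball is the whole space, and so is every concentric ball of radius larger than its
   diameter d. *)
exists (2 * d); split => //; first by rewrite mulr_gt0.
  apply/seteqP; split => z _ //; rewrite mem_ball.
  by apply: le_lt_trans (xz z) _; lra.
apply/seteqP; split => z _; rewrite mem_ball; apply: le_lt_trans (xz z) _.
  by apply: lt_le_trans (_ : r <= _); [lra|rewrite ler_peMl// ltW].
by apply: lt_le_trans (_ : 2 * d <= _); [lra|rewrite ler_peMl//; lra].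
Qed.

Lemma adm_dist u K c : lipk K u -> (exists M, forall z : Y, `|u z| <= M) ->
  adm (fun z => `|u z - c|).
Proof.
move=> uK [M uM]; split.
- apply: (measurableT_comp (@normr_measurable R setT)).
  by apply: measurable_funB => //; exact: lipk_measurable uK.
- by move=> z.
- exists (M + `|c|) => z; apply: le_trans (ler_normB _ _) _; exact: lerD.
Qed.

(** The average is within a factor 2 of the best constant, so any convenient c can replace it. *)
Lemma mean_oscillation u K x r c : 0 < r -> lipk K u ->
  (exists M, forall z : Y, `|u z| <= M) ->
  mint nu (fun z => `|u z - avg nu (ball x r) u|) (ball x r) <=
    2 * mint nu (fun z => `|u z - c|) (ball x r).
Proof.
move=> r0 uK uM; set m := avg _ _ _.
have V0 := vol_ball_gt0 dC x r0.
have mB : measurable (ball x r : set (borelType Y)) by exact: borel_ball.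
have fB := fnu x r.
have ac := adm_dist c uK uM; have am := adm_dist m uK uM.
have iu : nu.-integrable (ball x r) (EFin \o (u : borelType Y -> R)).
  have [M hM] := uM.
  apply: measurable_bounded_integrable => //.
    by apply: measurable_funS (lipk_measurable uK).
  exists M; split; first exact: num_real.
  by move=> N MN z _ /=; apply: le_trans (hM z) (ltW MN).
have ic : nu.-integrable (ball x r) (EFin \o (fun=> c : R)).
  apply: measurable_bounded_integrable => //.
  exists `|c|; split; [exact: num_real|by move=> N cN z _ /=; exact: ltW].
have cm : `|c - m| * vol nu (ball x r) <= mint nu (fun z => `|u z - c|) (ball x r).
  rewrite -{1}(gtr0_norm V0) -normrM mulrBl -[c * _](mint_cst nu c mB).
  have -> : m * vol nu (ball x r) = mint nu u (ball x r).
    by rewrite /m /avg -/(vol _ _) mulrAC mulVf ?gt_eqF// mul1r.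
  rewrite distrC /mint -RintegralB//.
  apply: le_normr_Rintegral => //.
  have := integrableB mB iu ic; apply: eq_integrable => //.
apply: (@le_trans _ _ (mint nu (fun z => `|u z - c| + `|c - m|) (ball x r))).
  apply: le_mint => //; first by apply: admD => //; exact: adm_cst.
  move=> z _; rewrite (_ : u z - m = (u z - c) + (c - m)); last by ring.
  exact: ler_normD.
rewrite mintD//; last exact: adm_cst.
by rewrite mint_cst//; lra.
Qed.

Variables (Lam1 Cst q Dil : R) (m : nat).
Hypothesis Lam10 : 0 < Lam1.
Hypothesis Cst0 : 0 < Cst.
Hypothesis q2 : 2 <= q.
Hypothesis hD : 1 + 4 * Lam1 <= Dil.
Hypothesis hm : Dil <= 2 ^+ m.
Hypothesis hq : C ^+ 2 * C ^+ m * 2 <= 2 `^ q.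

(* Kolmogorov's argument: the weak type bound at the dyadic levels 2^n a is
   summable since q >= 2. *)
Lemma osc_integral u K y r a : 0 <= K -> lipk K u ->
  (exists M, forall z : Y, `|u z| <= M) ->
  (forall tau, 0 < tau -> osc_bound nu Lam1 Cst q u tau) -> 0 < r -> 0 < a ->
  mint nu (fun z => glip u z `^ q) (ball y (Dil * r)) <=
    a `^ q * vol nu (ball y (Dil * r)) ->
  exists c, mint nu (fun z => `|u z - c|) (ball y r) <=
    12 * (Cst * a * r) * vol nu (ball y r).
Proof.
move=> K0 uK uM H r0 a0 ha.
have q0 : 0 <= q by exact: le_trans (ler0n _ 2) q2.
pose h z := glip u z `^ q.
have ah : adm h by apply: adm_powR q0 (adm_glip K0 uK).
have V0 := vol_ball_gt0 dC y r0; set V := vol nu (ball y r) in V0 *.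
have aq0 : 0 < a `^ q by exact: powR_gt0.
have [lam lamE] : exists lam : nat -> R, forall n, lam n = (2 ^+ n * a) `^ q.
  by exists (fun n => (2 ^+ n * a) `^ q).
have lam0 n : 0 < lam n by rewrite lamE powR_gt0// mulr_gt0// exprn_gt0.
(* Starting at level 1 supplies a factor [2 ^ q] that absorbs the covering constants, so already
   [E 0] has at most half the measure of the ball. The radius is set for pairs of points at distance
   less than [2 * r]. *)
pose E n := bad nu h (2 * Lam1 * r) (lam n.+1) y r.
have mE n : measurable (E n : set (borelType Y)) by apply: borel_open; exact: bad_open.
have pw n : 4 ^+ n.+1 <= (2 `^ q) ^+ n.+1 :> R.
  apply: lerXn2r; rewrite ?nnegrE ?powR_ge0//.
  apply: (@le_trans _ _ (2 `^ 2)); last by apply: ler_powR => //; rewrite ler1n.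
  by rewrite powR_mulrn//; lra.
have hE n : vol nu (E n) <= V / 2 / 4 ^+ n.
  apply: vol_leE; apply: le_trans (bad_measure fnu dC inu _ _ _ ah (lam0 _)) _.
  rewrite lee_fin (_ : r + 2 * (2 * Lam1 * r) = (1 + 4 * Lam1) * r); last by ring.
  have hV : vol nu (ball y (Dil * r)) <= C ^+ m * V.
    by apply: (vol_ball_le fnu dC) => //; rewrite mdistxx add0r ler_pM2r.
  have Q0 : 0 < (2 `^ q) ^+ n.+1 :> R by rewrite exprn_gt0// powR_gt0.
  have lE : lam n.+1 = (2 `^ q) ^+ n.+1 * a `^ q.
    rewrite lamE powRM ?exprn_ge0// ?(ltW a0)//; congr (_ * _).
    by rewrite -(powR_mulrn _ (ler0n _ 2)) -(powR_mulrn _ (powR_ge0 2 q)) -!powRrM mulrC.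
  apply: (@le_trans _ _ (C ^+ 2 * (a `^ q * (C ^+ m * V) / lam n.+1))).
    apply: ler_wpM2l; first by rewrite exprn_ge0// ltW.
    apply: ler_wpM2r; first by rewrite invr_ge0 ltW.
    apply: (@le_trans _ _ (mint nu h (ball y (Dil * r)))).
      apply: (mint_subset ah (borel_ball _ _) (borel_ball _ _) (fnu _ _)).
      by apply: sub_ball; rewrite mdistxx add0r; apply: ler_wpM2r => //; exact: ltW.
    by apply: le_trans ha _; apply: ler_wpM2l => //; exact: ltW.
  have -> : C ^+ 2 * (a `^ q * (C ^+ m * V) / lam n.+1) =
     (C ^+ 2 * C ^+ m * 2) / (2 `^ q) * (V / 2 / (2 `^ q) ^+ n).
    rewrite lE (exprS (2 `^ q)); field; rewrite !gt_eqF// ?exprn_gt0// powR_gt0//.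
  have Qn : 0 < (2 `^ q) ^+ n :> R by rewrite exprn_gt0// powR_gt0.
  apply: (@le_trans _ _ (V / 2 / (2 `^ q) ^+ n)).
    apply: ler_piMl; first by rewrite !divr_ge0// ltW.
    by rewrite ler_pdivrMr ?powR_gt0// mul1r.
  apply: ler_wpM2l; first by rewrite divr_ge0// ltW.
  rewrite lef_pV2 ?posrE ?exprn_gt0//.
  case: (n) => [|k]; first by rewrite !expr0.
  exact: pw.
have [x0 yx0 Ex0] : exists2 x0, ball y r x0 & ~ E 0%N x0.
  apply: contrapT => no.
  have BE : ball y r `<=` E 0%N.
    by move=> z yz; apply: contrapT => Ez; apply: no; exists z.
  have fE : (nu (E 0%N) < +oo)%E.
    by apply: le_lt_trans (bad_measure fnu dC inu _ _ _ ah (lam0 _)) _; exact: ltry.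
  have := le_trans (le_vol (borel_ball y r) (mE 0%N) fE BE) (hE 0%N).
  by rewrite expr0 divr1 -/V leNgt ltr_pdivrMr// ltr_pMr// ltr1n.
exists (u x0).
have [X XE] : exists X, X = 2 * (Cst * a * r) by eexists.
have X0 : 0 < X by rewrite XE !mulr_gt0.
have lam_le n : lam 1%N <= lam n.+1.
  have p2 k : 0 <= 2 ^+ k * a by rewrite mulr_ge0 ?exprn_ge0// ltW.
  rewrite !lamE; apply: (ge0_ler_powR q0); rewrite ?nnegrE ?p2//.
  by rewrite ler_pM2r// ler_eXn2l// ltr1n.
have level n z : ball y r z -> ~ E n z -> `|u z - u x0| <= X * 2 ^+ n.+1.
  rewrite mem_ball => yz Ez; move: (yx0); rewrite mem_ball => yx.
  have gz := notbad_good yz Ez.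
  have gx : good nu h (2 * Lam1 * r) (lam n.+1) x0.
    by apply: good_le (notbad_good yx Ex0) => //; exact: lam_le.
  have ta : 0 < 2 ^+ n.+1 * a by rewrite mulr_gt0// exprn_gt0.
  have zx : mdist z x0 < 2 * r.
    by have := metric_triangle z y x0; rewrite (metric_sym z y); lra.
  have LE : 2 * Lam1 * r = Lam1 * (2 * r) by ring.
  rewrite lamE LE in gz; rewrite lamE LE in gx.
  have := H _ ta z x0 (2 * r) (mulr_gt0 (ltr0Sn _ 1) r0) zx gz gx.
  by move/le_trans; apply; rewrite XE le_eqVlt; apply/orP; left; apply/eqP; ring.
have fE n : (nu (E n) < +oo)%E.
  by apply: le_lt_trans (bad_measure fnu dC inu _ _ _ ah (lam0 _)) _; exact: ltry.
clearbody E.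
(* A step function dominating the oscillation divided by X: a point of [E i] outside [E i.+1] is
   paid for by the term [2 ^+ i.+2]. *)
pose g n z : R := 2 + \sum_(i < n) 2 ^+ i.+2 * \1_(E i) z.
have g0 z : g 0%N z = 2 by rewrite /g big_ord0 addr0.
have gS n z : g n.+1 z = g n z + 2 ^+ n.+2 * \1_(E n) z.
  by rewrite /g big_ord_recr/= addrA.
clearbody g.
have aI n : adm (fun z => 2 ^+ n.+2 * \1_(E n) z : R).
  by apply: admZ; [exact: exprn_ge0|exact: adm_indic].
have ag n : adm (g n).
  elim: n => [|n IH].
    by rewrite (_ : g 0%N = fun=> 2); [exact: adm_cst|apply/funext].
  rewrite (_ : g n.+1 = fun z => g n z + 2 ^+ n.+2 * \1_(E n) z); last exact/funext.
  exact: admD.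
have mB : measurable (ball y r : set (borelType Y)) by exact: borel_ball.
have fB := fnu y r.
(* The n-th term contributes at most [2 * V / 2 ^+ n], a geometric series. *)
have ig n : mint nu (g n) (ball y r) <= (6 - 4 / 2 ^+ n) * V.
  elim: n => [|n IH].
    rewrite (_ : g 0%N = fun=> 2); last exact/funext.
    by rewrite mint_cst// expr0 -/V; lra.
  rewrite (_ : g n.+1 = fun z => g n z + 2 ^+ n.+2 * \1_(E n) z); last exact/funext.
  rewrite mintD// mintZ//; last exact: adm_indic.
  rewrite mint_indic//.
  have h1 : vol nu (E n `&` ball y r) <= V / 2 / 4 ^+ n.
    by apply: le_trans (hE n); apply: le_vol => //; exact: measurableI.
  have h2 : 2 ^+ n.+2 * vol nu (E n `&` ball y r) <= 2 ^+ n.+2 * (V / 2 / 4 ^+ n).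
    by apply: ler_wpM2l => //; exact: exprn_ge0.
  apply: le_trans (lerD IH h2) _; rewrite le_eqVlt; apply/orP; left; apply/eqP.
  rewrite (_ : 4 = 2 ^+ 2 :> R); last by rewrite expr2; ring.
  rewrite -exprM mulnC exprM expr2 !exprS; field.
  by rewrite expf_neq0.
have dom n z : ball y r z -> ~ E n z -> `|u z - u x0| <= X * g n z.
  elim: n => [|n IH] yz Ez; first by rewrite g0 -[2]expr1; exact: level.
  rewrite gS; have [Enz|Enz] := pselect (E n z); last first.
    by rewrite indicE memNset// mulr0 addr0; exact: IH.
  apply: le_trans (level n.+1 z yz Ez) _; apply: ler_wpM2l; first exact: ltW.
  by rewrite indicE mem_set// mulr1 lerDr; have [_ gp _] := ag n; exact: gp.
(* From level M on the Lipschitz bound alone is enough, so finitely many levels cover every point of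
   the ball. *)
have [M hM] := exp2_ge (K / (Cst * a)).
have dom2 z : ball y r z -> `|u z - u x0| <= X * g M.+1 z.
  move=> yz; rewrite gS; have [Ez|Ez] := pselect (E M z); last first.
    rewrite indicE memNset// mulr0 addr0; exact: dom.
  have [_ gp _] := ag M.
  apply: (@le_trans _ _ (X * 2 ^+ M.+2)); last first.
    apply: ler_wpM2l; first exact: ltW.
    by rewrite indicE mem_set// mulr1 lerDr.
  apply: le_trans (uK _ _) _.
  have zx : mdist z x0 <= 2 * r.
    move: yz yx0; rewrite !mem_ball => yz yx.
    by have := metric_triangle z y x0; rewrite (metric_sym z y); lra.
  rewrite ler_pdivrMr ?mulr_gt0// in hM.
  apply: (@le_trans _ _ (2 ^+ M * (Cst * a) * (2 * r))).
    by apply: ler_pM => //; exact: mdist_ge0.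
  have -> : 2 ^+ M * (Cst * a) * (2 * r) = X * 2 ^+ M by rewrite XE; ring.
  by apply: ler_wpM2l; [exact: ltW|rewrite ler_weXn2l// ?ler1n//; apply: leqW].
apply: (@le_trans _ _ (mint nu (fun z => X * g M.+1 z) (ball y r))).
  apply: le_mint => //; [exact: adm_dist uK uM|apply: admZ => //; exact: ltW].
rewrite mintZ//.
apply: (@le_trans _ _ (X * (6 * V))); last first.
  by rewrite XE le_eqVlt; apply/orP; left; apply/eqP; ring.
apply: ler_wpM2l; first exact: ltW.
apply: le_trans (ig _) _; apply: ler_wpM2r; first exact: ltW.
by rewrite gerBl divr_ge0// exprn_ge0.
Qed.


Lemma poincare_of_osc Th : chain_connected (Y := Y) Th -> 48 * Cst <= Dil ->
  (forall u K tau, 0 <= K -> lipk K u -> 0 < tau -> osc_bound nu Lam1 Cst q u tau) ->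
  poincare nu q.
Proof.
move=> cc hDC H.
have q0 : 0 < q by apply: lt_le_trans q2; rewrite ltr0n.
have D1 : 1 <= Dil by apply: le_trans hD; rewrite lerDl mulr_ge0// ltW.
have D0 : 0 < Dil by exact: lt_le_trans ltr01 D1.
(* [Dil] serves both as the dilation and as the multiplicative constant. *)
exists Dil => // x r u r0 [K' uK'] cu.
have [K K0 uK] : exists2 K, 0 <= K & lipk K u.
  exists (Num.max K' 0); first by rewrite le_max lexx orbT.
  move=> a b; apply: le_trans (uK' a b) _.
  by rewrite ler_wpM2r ?mdist_ge0// le_max lexx.
have uM : exists M, forall z : Y, `|u z| <= M.
  have cuK : compact (u @` closure [set x0 | u x0 != 0]).
    apply: continuous_compact => //; apply: continuous_subspaceT.
    exact: lipk_continuous uK.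
  have [M [_ hM]] := compact_bounded cuK.
  exists (`|M| + 1) => z; have [uz|uz] := eqVneq (u z) 0.
    by rewrite uz normr0 addr_ge0.
  apply: (hM (`|M| + 1)); first by rewrite ltr_pwDr// ler_norm.
  by exists z => //; exact: subset_closure.
set mB := avg nu (ball x r) u.
have am := adm_dist mB uK uM.
pose h z := glip u z `^ q.
have ah : adm h by apply: adm_powR (ltW q0) (adm_glip K0 uK).
have V0 := vol_ball_gt0 dC x r0.
have W0 : 0 < vol nu (ball x (Dil * r)) by apply: (vol_ball_gt0 dC); rewrite mulr_gt0.
rewrite /eavg -mintE//; [|exact: borel_ball].
have -> : (\int[nu]_(z in ball x (Dil * r)) (Lip u z `^ q))%E =
    (mint nu h (ball x (Dil * r)))%:E.
  rewrite mintE//; last exact: borel_ball.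
  by apply: eq_integral => z _; rewrite (glipE z K0 uK) poweR_EFin.
rewrite -!EFinM lee_fin -!/(vol _ _) mulrC ler_pdivrMr//.
set S := (_^-1 * mint nu h _).
have S0 : 0 <= S by rewrite mulr_ge0 ?mint_ge0// invr_ge0 ltW.
have d0 : 0 <= diam (ball x r).
  by rewrite -(mdistxx x); apply: mdist_le_diam; exact: ball_ctr.
have T0 : 0 <= Dil * diam (ball x r) by rewrite mulr_ge0// ltW.
have [triv|[r' [r'0 Br' Wr' r'd]]] := radius_le_diam x cc D1 r0.
  apply: (le_trans (mean_oscillation x (u x) r0 uK uM)).
  apply: (@le_trans _ _ 0); last by rewrite !mulr_ge0 ?powR_ge0// ltW.
  rewrite pmulr_rle0// -(mul0r (vol nu (ball x r))) -mint_cst; last exact: borel_ball.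
  apply: le_mint => //; [exact: adm_dist uK uM|exact: adm_cst|exact: borel_ball|].
  by move=> z _; rewrite (triv z) subrr normr0.
(* The average S may vanish while [osc_integral] needs a positive level, so the level is raised by
   eta, chosen to cost less than e in total. *)
apply/ler_addgt0Pl => e e0.
pose eta := e / (Dil * diam (ball x r) * vol nu (ball x r) + 1).
have eta0 : 0 < eta by rewrite divr_gt0// ltr_wpDl// mulr_ge0// ltW.
pose a := S `^ q^-1 + eta.
have a0 : 0 < a by rewrite ltr_wpDl// powR_ge0.
have Sa : S <= a `^ q.
  have -> : S = (S `^ q^-1) `^ q by rewrite -powRrM mulVf ?gt_eqF// powRr1.
  apply: (ge0_ler_powR (ltW q0)); rewrite ?nnegrE ?powR_ge0 ?(ltW a0)//.
  by rewrite lerDl ltW.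
have [c hc] : exists c, mint nu (fun z => `|u z - c|) (ball x r') <=
    12 * (Cst * a * r') * vol nu (ball x r').
  apply: (osc_integral K0 uK uM _ r'0 a0) => [tau t0|]; first exact: H K0 uK t0.
  by rewrite Wr' -ler_pdivrMr// mulrC.
rewrite Br' in hc.
apply: (le_trans (mean_oscillation x c r0 uK uM)).
apply: (@le_trans _ _ (Dil * diam (ball x r) * a * vol nu (ball x r))).
  apply: (@le_trans _ _ (2 * (12 * (Cst * a * r') * vol nu (ball x r)))).
    by rewrite ler_pM2l.
  rewrite mulrA; apply: ler_wpM2r; first exact: ltW.
  (* 48 collects 2 from the mean oscillation, 12 from [osc_integral] and 2 from comparing [r'] with
     the diameter. *)
  apply: (@le_trans _ _ (48 * Cst * (r' / 2) * a)).
    by rewrite le_eqVlt; apply/orP; left; apply/eqP; field.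
  apply: ler_wpM2r; first exact: ltW.
  apply: ler_pM => //; [by rewrite mulr_ge0// ltW|by rewrite divr_ge0// ltW|].
  by rewrite ler_pdivrMr// mulrC.
rewrite /a mulrDr mulrDl addrC lerD2r.
rewrite mulrAC /eta mulrA ler_pdivrMr; last by rewrite ltr_wpDl// mulr_ge0// ltW.
by rewrite mulrC ler_pM2l// lerDl.
Qed.

End poincare_from_osc.

(** * Constants of the quotient map and conclusion *)

Lemma lipschitz_quotient_cst (R : realType) (X Y : metricType R) (f : X -> Y) :
  lipschitz_quotient f -> exists L, [/\ 1 <= L,
    forall x x', mdist (f x) (f x') <= L * mdist x x' &
    forall x y r, mdist (f x) y < r -> exists2 x', mdist x x' < L * r & f x' = y].
Proof.
move=> [L L0 hL]; have ML : L <= Num.max L 1 by rewrite le_max lexx.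
exists (Num.max L 1); split; first by rewrite le_max lexx orbT.
- move=> x x'; apply: (@le_trans _ _ (L * mdist x x')); last first.
    by apply: ler_wpM2r => //; exact: mdist_ge0.
  apply/ler_addgt0Pr => e e0.
  (* Balls are open, so the radius must slightly exceed the distance. *)
  have r0 : 0 < mdist x x' + e / L by rewrite ltr_wpDl ?mdist_ge0// divr_gt0.
  have [_ /(_ (f x'))] := hL x _ r0; rewrite mem_ball.
  have -> : L * (mdist x x' + e / L) = L * mdist x x' + e by field; rewrite gt_eqF.
  by move=> h; apply: ltW; apply: h; exists x' => //; rewrite mem_ball ltrDl divr_gt0.
- move=> x y r xy; have r0 : 0 < r by apply: le_lt_trans xy; exact: mdist_ge0.
  have [/(_ y) h _] := hL x (L * r) (mulr_gt0 L0 r0).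
  rewrite mulrA mulVf ?gt_eqF// mul1r mem_ball in h.
  have [x' xx' fx'] := h xy; exists x' => //; move: xx'; rewrite mem_ball.
  by move/lt_le_trans; apply; apply: ler_wpM2r => //; exact: ltW.
Qed.

Theorem theorem1p8 (R : realType) (X Y : pmetricType R)
    (mu : {measure set (borelType X) -> \bar R}) (f : X -> Y)
    (hX : PI_space mu) (hf : lipschitz_quotient f)
    (nu := pushforward_measure mu (lipschitz_quotient_measurable hf))
    (hfin : exists (y : Y) (r : R), 0 < r /\ (nu (ball y r) < +oo)%E) :
  PI_space nu.
Proof.
have [p p1 [cX [_ imu] dX pX]] := hX.
have [fmu [C dC]] := doubling_cstP dX.
have [L [L1 fLip fLift]] := lipschitz_quotient_cst hf.
have dnu : doubling nu := push_doubling L1 fLip fLift fmu dC imu hfin.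
have [fnu [C' dC']] := doubling_cstP dnu.
have inu : inner_regular nu := inner_regular_push hf imu.
have prX : forall (A : set X) x r, closed A -> A `<=` ball x r -> compact A.
  by move=> A x r; exact: (closed_bounded_compact fmu dC cX).
have pp : two_point_poincare nu p.
  exact: (two_point_poincare_push L1 fLip fLift fmu dC imu fnu dC' prX p1 pX).
have [Lam1 [Cst [q0 [Lam10 Cst0 hosc]]]] := core_osc fnu dC' inu p1 pp.
have [Th _ cc] := two_point_poincare_chain fnu p1 pp.
pose Dil := 1 + 4 * Lam1 + 48 * Cst.
have hD1 : 1 + 4 * Lam1 <= Dil by rewrite lerDl mulr_ge0// ltW.
have hD2 : 48 * Cst <= Dil by rewrite lerDr addr_ge0// mulr_ge0// ltW.
have [m hm] := exp2_ge Dil.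
have [q1 hq1] := powR2_ge (C' ^+ 2 * C' ^+ m * 2).
(* q0 gives the pointwise estimate, 2 the summability over dyadic levels, and q1 beats the doubling
   constant for the dilation [Dil], which is fixed before q. *)
pose q := Num.max q0 (Num.max 2 q1).
have q2 : 2 <= q by rewrite /q !le_max lexx orbT.
have qq0 : q0 <= q by rewrite /q le_max lexx.
have qq1 : q1 <= q by rewrite /q !le_max lexx !orbT.
exists q; first by apply: le_trans q2; rewrite ler1n.
split => //.
- exact: (complete_push hf fLift prX).
- split=> // y; exists (ball y 1) => //.
  by split; [exact: open_mball|exact: ball_ctr].
- apply: (poincare_of_osc fnu dC' inu Lam10 Cst0 q2 hD1 hm (hq1 _ qq1) cc hD2).
  exact: hosc.
Qed.
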